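(* Let $a\ge 3$ be an integer and let $\mathfrak g$ be the Kac-Moody Lie algebra over $\mathbb C$ with Cartan matrix $\begin{pmatrix}2&-a\\-a&2\end{pmatrix}$. For $i,j\in\mathbb Z_{\ge0}$, let $E^+=E^+(i,j)$ be the eigenvalue other than $1$ of the Casimir element acting on $\mathfrak h$, for an $\mathfrak{sl}_2$-triple $X=c_0E_0+c_1E_1$, $Y=\omega_0(X)$, $H=[X,Y]$ with $0\ne E_0\in\mathfrak g_{F_{i+1}\alpha_0+F_i\alpha_1}$ and $0\ne E_1\in\mathfrak g_{F_j\alpha_0+F_{j+1}\alpha_1}$. Then $E^+$ is strictly increasing in $i$ and in $j$, $$-\frac{a+2}{a-2}\le E^+<-1,$$ and $$\lim_{i\to\infty}E^+=-1\ \text{ (for each fixed } j),\qquad \lim_{j\to\infty}E^+=-1\ \text{ (for each fixed } i).$$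
   Context: Let $e_i,f_i,h_i$ ($i=0,1$) be the Chevalley generators of $\mathfrak g$, $\mathfrak h=\mathbb Ch_0\oplus\mathbb Ch_1$ the Cartan subalgebra, $\alpha_0,\alpha_1$ the simple roots ($\langle h_i,\alpha_j\rangle=a_{ij}$, the entries of the Cartan matrix), $\mathfrak g_\gamma$ the root space of a root $\gamma$, and $\mathfrak n^+$ (resp. $\mathfrak n^-$) the subalgebra generated by the $e_i$ (resp. $f_i$). The compact involution $\omega_0$ is the antilinear automorphism of $\mathfrak g$ with $\omega_0(e_i)=-f_i$, $\omega_0(f_i)=-e_i$, $\omega_0(h)=-h$ for $h\in\mathbb Rh_0\oplus\mathbb Rh_1$. An $\mathfrak{sl}_2$-triple in $\mathfrak g$ consists of nonzero elements $X\in\mathfrak n^+$, $Y\in\mathfrak n^-$, $H\in\mathfrak h$ with $[H,X]=2X$, $[H,Y]=-2Y$, $[X,Y]=H$. The sequence $F_n$ is defined by $F_0=0$, $F_1=1$, $F_{k+2}=aF_{k+1}-F_k$. For all $i,j\ge0$ and all nonzero $E_0\in\mathfrak g_{F_{i+1}\alpha_0+F_i\alpha_1}$, $E_1\in\mathfrak g_{F_j\alpha_0+F_{j+1}\alpha_1}$, there exist $c_0,c_1\in\mathbb C$ for which $X=c_0E_0+c_1E_1$, $Y=\omega_0(X)$, $H=[X,Y]$ form an $\mathfrak{sl}_2$-triple. The Casimir element of the $\mathfrak{sl}_2$ subalgebra spanned by $X,Y,H$ is $c_L=\frac18H^2+\frac14XY+\frac14YX$ in its universal enveloping algebra; it acts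 on $\mathfrak g$ through the adjoint action and preserves the two-dimensional space $\mathfrak h$. One eigenvalue of $c_L$ on $\mathfrak h$ is $1$ (with eigenvector $H$), and $E^+$ denotes the other one. Explicitly, $$E^+=-\frac{B+2}{B-2},\qquad B=alm-2km+akn-2ln,$$ where $k=F_{i+1},\ l=F_i,\ m=F_j,\ n=F_{j+1}$; in particular $E^+$ depends only on $a,i,j$. *)

(* Defs.v *)
From HB Require Import structures.
From mathcomp Require Import all_boot all_order all_algebra.
From mathcomp Require Import all_classical all_reals all_analysis.
From mathcomp Require Import complex.

Set Implicit Arguments.
Unset Strict Implicit.
Unset Printing Implicit Defensive.

Import Order.TTheory GRing.Theory Num.Theory.
Import numFieldNormedType.Exports.

Local Open Scope classical_set_scope.
Local Open Scope complex_scope.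
Local Open Scope ring_scope.

HB.mixin Record Lmodule_isLie (K : comNzRingType) L of GRing.Lmodule K L := {
  lie : L -> L -> L;
  lieDl : forall x y z, lie (x + y) z = lie x z + lie y z;
  lieZl : forall (c : K) x y, lie (c *: x) y = c *: lie x y;
  lieDr : forall x y z, lie x (y + z) = lie x y + lie x z;
  lieZr : forall (c : K) x y, lie x (c *: y) = c *: lie x y;
  liexx : forall x, lie x x = 0;
  jacobi : forall x y z,
    lie x (lie y z) + lie y (lie z x) + lie z (lie x y) = 0
}.

#[short(type="lieAlgType")]
HB.structure Definition LieAlgebra (K : comNzRingType) :=
  { L of GRing.Lmodule K L & Lmodule_isLie K L }.

Notation "[lie x , y ]" := (lie x y)
  (at level 0, x at level 99, y at level 99, format "[lie  x ,  y ]")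
  : ring_scope.

Section LieAlgebras.
Context {K : comNzRingType} {g : lieAlgType K}.

Definition subspace (S : set g) : Prop :=
  [/\ S 0, (forall x y, S x -> S y -> S (x + y))
    & (forall (c : K) x, S x -> S (c *: x))].

Definition lie_subalgebra (S : set g) : Prop :=
  subspace S /\ (forall x y, S x -> S y -> S [lie x, y]).

Definition lie_ideal (S : set g) : Prop :=
  subspace S /\ (forall x y, S y -> S [lie x, y]).

Definition lie_generated (G : set g) : set g := smallest lie_subalgebra G.

Definition lin_span (n : nat) (v : 'I_n -> g) : set g :=
  [set x | exists c : 'I_n -> K, x = \sum_i c i *: v i].

Definition lin_free (n : nat) (v : 'I_n -> g) : Prop :=
  forall c : 'I_n -> K, \sum_i c i *: v i = 0 -> forall i, c i = 0.

(* g is the Kac-Moody algebra g(A) with Chevalley generators e, f, h, in Kac's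
   characterization.  A is required to be nondegenerate: then the realization
   of A has dimension n, so the Cartan subalgebra is the span of the h_i, and
   the simple roots are determined by <h_i, alpha_j> = A i j. *)
Record is_kac_moody (n : nat) (A : 'M[int]_n) (e f h : 'I_n -> g) : Prop := {
  km_nondegenerate : \det A != 0;
  km_free : lin_free h;
  km_hh : forall i j, [lie h i, h j] = 0;
  km_he : forall i j, [lie h i, e j] = (A i j)%:~R *: e j;
  km_hf : forall i j, [lie h i, f j] = - ((A i j)%:~R *: f j);
  km_ef : forall i j, [lie e i, f j] = if i == j then h i else 0;
  km_generated :
    lie_generated (range e `|` range f `|` range h) = [set: g];
  km_ideal : forall I : set g, lie_ideal I ->
    I `&` lin_span h = [set 0] -> I = [set 0]
}.

(* A weight is given by the column of its values on h_0, ..., h_(n-1); thus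
   alpha_j is the j-th column of the Cartan matrix. *)
Definition simple_root (n : nat) (A : 'M[int]_n) (j : 'I_n) : 'cV[int]_n :=
  col j A.

Definition root_space (n : nat) (h : 'I_n -> g) (gamma : 'cV[int]_n) : set g :=
  [set x | forall i, [lie h i, x] = (gamma i ord0)%:~R *: x].

Definition sl2_triple (n : nat) (e f h : 'I_n -> g) (X Y H : g) : Prop :=
  [/\ X != 0, Y != 0 & H != 0] /\
  [/\ lie_generated (range e) X, lie_generated (range f) Y & lin_span h H] /\
  [/\ [lie H, X] = 2 *: X, [lie H, Y] = - (2 *: Y) & [lie X, Y] = H].

End LieAlgebras.

(* adjoint action of H^2 / 8 + X Y / 4 + Y X / 4, an element of the enveloping
   algebra of the span of X, Y, H *)
Definition casimir (K : fieldType) (g : lieAlgType K) (X Y H v : g) : g :=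
  8^-1 *: [lie H, [lie H, v]] + 4^-1 *: [lie X, [lie Y, v]]
  + 4^-1 *: [lie Y, [lie X, v]].

Definition eigenvalue_on (K : fieldType) (g : lieAlgType K)
    (S : set g) (T : g -> g) (z : K) : Prop :=
  exists v, [/\ S v, v != 0 & T v = z *: v].

(* By antilinearity, omega (h i) = - h i amounts to omega = -1 on the real
   span of the h i. *)
Record is_compact_involution (R : realType) (g : lieAlgType R[i]) (n : nat)
    (e f h : 'I_n -> g) (omega : g -> g) : Prop := {
  ci_bij : bijective omega;
  ci_add : forall x y, omega (x + y) = omega x + omega y;
  ci_antilinear : forall (c : R[i]) x, omega (c *: x) = c^*%C *: omega x;
  ci_lie : forall x y, omega [lie x, y] = [lie omega x, omega y];
  ci_e : forall i, omega (e i) = - f i;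
  ci_f : forall i, omega (f i) = - e i;
  ci_h : forall i, omega (h i) = - h i
}.

Definition cartan_matrix (a : int) : 'M[int]_2 :=
  \matrix_(i, j) if i == j then 2 else - a.

Fixpoint F (a : int) (n : nat) : int :=
  match n with
  | 0%N => 0
  | 1%N => 1
  | (k.+1 as m).+1 => a * F a m - F a k
  end.

Definition beta0 (a : int) (i : nat) : 'cV[int]_2 :=
  F a i.+1 *: simple_root (cartan_matrix a) 0
  + F a i *: simple_root (cartan_matrix a) 1.

Definition beta1 (a : int) (j : nat) : 'cV[int]_2 :=
  F a j *: simple_root (cartan_matrix a) 0
  + F a j.+1 *: simple_root (cartan_matrix a) 1.

Definition is_Eplus (R : realType) (a : int) (g : lieAlgType R[i])
    (e f h : 'I_2 -> g) (omega : g -> g) (i j : nat) (z : R[i]) : Prop :=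
  exists (E0 E1 : g) (c0 c1 : R[i]),
    let X := c0 *: E0 + c1 *: E1 in
    let Y := omega X in
    let H := [lie X, Y] in
    [/\ root_space h (beta0 a i) E0 /\ E0 != 0,
        root_space h (beta1 a j) E1 /\ E1 != 0,
        sl2_triple e f h X Y H,
        eigenvalue_on (lin_span h) (casimir X Y H) z
      & z != 1].

(* Main.v *)
From HB Require Import structures.
Require Import Defs.
From mathcomp Require Import all_boot all_order all_algebra.
From mathcomp Require Import all_classical all_reals all_analysis.
From mathcomp Require Import complex.
From mathcomp Require Import ring zify.

Import Order.TTheory GRing.Theory Num.Theory.
Import numFieldNormedType.Exports.

(** The roots [beta0], [beta1] are real, of square norm 2.  The key fact is that
[[E, omega E] = - p nu(beta)] with [p >= 0] for [E] in the root space of a positive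
real root [beta], [nu] being the identification of the dual of the Cartan
subalgebra with itself.  This is proved by descent on the height of [beta] along
simple reflections, using only the [sl_2]-strings inside [g]; the vanishing of
non-root spaces needed on the way comes from local nilpotency of the [ad e_i] and the
same descent.  The sign [p >= 0] excludes [c_0 = 0] and [c_1 = 0], and the
relation [[H, X] = 2 X] then forces [H = q (nu(beta0) + nu(beta1))] with
[q = -2 / (B - 2)], [B = - (beta0, beta1)], from which [E^+ = - (B + 2) / (B - 2)].
Finally [B = F_(i+j+2) - F_(i+j)], which is strictly increasing in [i + j]. *)

Set Implicit Arguments.
Unset Strict Implicit.

Local Open Scope classical_set_scope.
Local Open Scope complex_scope.
Local Open Scope ring_scope.

(* Not the topological subspace of the same name. *)
Local Notation subspace := Defs.subspace.

(** * Lie algebras *)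

Section LieTheory.
Context {K : comNzRingType} {g : lieAlgType K}.
Implicit Types (x y z : g) (S U : set g).

HB.instance Definition _ x := GRing.isLinear.Build K g g _ (lie x)
  (fun c y z => etrans (lieDr x (c *: y) z) (congr1 (+%R^~ _) (lieZr c x y))).

Lemma lieC x y : [lie x, y] = - [lie y, x].
Proof.
apply/eqP; rewrite -addr_eq0; apply/eqP.
by have := liexx (x + y); rewrite lieDl !lieDr !liexx add0r addr0.
Qed.

Lemma lie0r x : [lie x, 0] = 0. Proof. exact: raddf0. Qed.
Lemma lieNr x y : [lie x, - y] = - [lie x, y]. Proof. exact: raddfN. Qed.
Lemma lieBr x y z : [lie x, y - z] = [lie x, y] - [lie x, z].
Proof. exact: raddfB. Qed.
Lemma lie0l x : [lie 0, x] = 0. Proof. by rewrite lieC lie0r oppr0. Qed.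
Lemma lieNl x y : [lie - x, y] = - [lie x, y].
Proof. by rewrite (lieC (- x)) lieNr (lieC x). Qed.

Lemma lie_der x y z :
  [lie x, [lie y, z]] = [lie [lie x, y], z] + [lie y, [lie x, z]].
Proof.
have := jacobi x y z; rewrite (lieC z x) lieNr (lieC z) => /eqP.
by rewrite -addrA -opprD subr_eq0 => /eqP ->; rewrite addrC.
Qed.

Lemma subspaceB S x y : subspace S -> S x -> S y -> S (x - y).
Proof. by move=> [_ D Z] Sx Sy; apply: D => //; rewrite -scaleN1r; apply: Z. Qed.

Lemma subspace_sum S (I : finType) (v : I -> g) :
  subspace S -> (forall i, S (v i)) -> S (\sum_i v i).
Proof. by move=> [S0 D Z] Sv; elim/big_ind: _. Qed.

Lemma subspace_lin_span S n (v : 'I_n -> g) :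
  subspace S -> (forall i, S (v i)) -> lin_span v `<=` S.
Proof.
move=> Ssub Sv _ [c ->]; apply: subspace_sum => // i.
by case: Ssub => _ _; apply.
Qed.

Lemma lin_span_subspace n (v : 'I_n -> g) : subspace (lin_span v).
Proof.
split.
- by exists (fun=> 0); rewrite big1 // => i _; rewrite scale0r.
- move=> _ _ [c ->] [d ->]; exists (fun i => c i + d i).
  by rewrite -big_split; apply: eq_bigr => i _; rewrite scalerDl.
- move=> c _ [d ->]; exists (fun i => c * d i).
  by rewrite scaler_sumr; apply: eq_bigr => i _; rewrite scalerA.
Qed.

Lemma mem_lin_span n (v : 'I_n -> g) i : lin_span v (v i).
Proof.
exists (fun j => (j == i)%:R); rewrite (bigD1 i) //= eqxx scale1r.
by rewrite big1 ?addr0 // => j /negbTE->; rewrite scale0r.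
Qed.

Lemma smallest_subspace (G : set g) : subspace (smallest subspace G).
Proof.
split=> [S [[]]//|x y Gx Gy S SG|c x Gx S SG].
  by have [[_ D _] _] := SG; apply: D; [apply: Gx|apply: Gy].
by have [[_ _ Z] _] := SG; apply: Z; apply: Gx.
Qed.

Lemma smallest_subspaceP (G S : set g) :
  subspace S -> G `<=` S -> smallest subspace G `<=` S.
Proof. by move=> Ss GS x; apply. Qed.

(** Lets stability of a linear span under ad x be checked on spanning vectors only. *)
Lemma preim_lie_subspace x U : subspace U -> subspace [set y | U [lie x, y]].
Proof.
move=> [U0 D Z]; split=> /= [|y z Uy Uz|c y Uy].
- by rewrite lie0r.
- by rewrite lieDr; apply: D.
- by rewrite lieZr; apply: Z.
Qed.

Lemma line_subspace x : subspace [set y | exists c : K, y = c *: x].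
Proof.
split=> /= [|_ _ [c ->] [d ->]|c _ [d ->]].
- by exists 0; rewrite scale0r.
- by exists (c + d); rewrite scalerDl.
- by exists (c * d); rewrite scalerA.
Qed.

Lemma subspace0 : subspace [set (0 : g)].
Proof. by split=> /= [//|x y -> ->|c x ->]; rewrite ?addr0 ?scaler0. Qed.

End LieTheory.

(** * Independence of weight spaces *)

Section RootSpaces.
Context {K : numFieldType} {g : lieAlgType K} {n : nat} (h : 'I_n -> g).
Hypothesis h_comm : forall i j, [lie h i, h j] = 0.
Implicit Types (x y : g) (gamma delta : 'cV[int]_n) (s : seq ('I_n * int)).

Lemma root_space_subspace gamma : subspace (root_space h gamma).
Proof.
split=> [|x y hx hy|c x hx] i; first by rewrite lie0r scaler0.
  by rewrite lieDr hx hy scalerDr.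
by rewrite lieZr hx scalerA mulrC -scalerA.
Qed.

Lemma root_space_lie gamma delta x y : root_space h gamma x ->
  root_space h delta y -> root_space h (gamma + delta) [lie x, y].
Proof.
move=> hx hy i; rewrite lie_der hx hy lieZl lieZr -scalerDl.
by rewrite mxE rmorphD.
Qed.

Lemma root_space_h i : root_space h 0 (h i).
Proof. by move=> j; rewrite h_comm mxE scale0r. Qed.

Let shift (p : 'I_n * int) x := [lie h p.1, x] - p.2%:~R *: x.
Let shifts s x := foldr shift x s.

Let shiftC p q x : shift p (shift q x) = shift q (shift p x).
Proof.
rewrite /shift !lieBr !lieZr !scalerBr !scalerA.
rewrite (lie_der (h p.1)) h_comm lie0l add0r [q.2%:~R * _]mulrC !opprB !addrA.
by rewrite [LHS]addrAC [RHS]addrAC; congr (_ + _); rewrite addrAC.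
Qed.

Let shiftD p x y : shift p (x + y) = shift p x + shift p y.
Proof. by rewrite /shift lieDr scalerDr opprD addrACA. Qed.

Let shiftZ p c x : shift p (c *: x) = c *: shift p x.
Proof. by rewrite /shift lieZr scalerBr !scalerA mulrC. Qed.

Let shiftsD s x y : shifts s (x + y) = shifts s x + shifts s y.
Proof. by elim: s => //= p s ->; rewrite shiftD. Qed.

Let shiftsZ s c x : shifts s (c *: x) = c *: shifts s x.
Proof. by elim: s => //= p s ->; rewrite shiftZ. Qed.

Let shifts0 s : shifts s 0 = 0.
Proof. by have := shiftsZ s 0 0; rewrite !scale0r. Qed.

Let shifts_shift s p x : shifts s (shift p x) = shift p (shifts s x).
Proof. by elim: s => //= q s ->; rewrite shiftC. Qed.

Let shiftsC s t x : shifts s (shifts t x) = shifts t (shifts s x).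
Proof. by elim: t x => //= p t IHt x; rewrite shifts_shift IHt. Qed.

(* Sums of weight vectors of weights other than gamma are killed by a product of
   operators [ad h_i - z] that is invertible on the root space of gamma. *)
Definition off_root_space gamma : set g := [set x |
  exists2 s, all (fun p => p.2 != gamma p.1 0) s & shifts s x = 0].

Lemma off_root_space_subspace gamma : subspace (off_root_space gamma).
Proof.
split=> [|x y [s sP sx] [t tP ty]|c x [s sP sx]].
- by exists [::].
- exists (s ++ t); first by rewrite all_cat sP.
  rewrite /shifts foldr_cat -!/(shifts _ _) !shiftsD ty.
  by rewrite [X in X + _]shiftsC sx !shifts0 addr0.
- by exists s => //; rewrite shiftsZ sx scaler0.
Qed.

Lemma root_space_off gamma delta x : gamma != delta ->
  root_space h delta x -> off_root_space gamma x.
Proof.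
move=> neq hx.
have [i neqi] : exists i, gamma i 0 != delta i 0.
  apply/existsP; apply: contra_neqT neq => /existsPn eqgd.
  by apply/colP => i; apply/eqP; have := eqgd i; rewrite negbK.
exists [:: (i, delta i 0)]; first by rewrite /= eq_sym neqi.
by rewrite /shifts /= /shift /= hx subrr.
Qed.

(** On a vector of weight [gamma] each factor ad h_i - z acts as the scalar gamma_i - z, which is
    nonzero by the choice of [s]. *)
Lemma root_space_off0 gamma x :
  root_space h gamma x -> off_root_space gamma x -> x = 0.
Proof.
move=> hx [s]; elim: s => [//|[i z] s IHs] /= /andP[zP sP].
have hs : root_space h gamma (shifts s x).
  elim: s {IHs sP} => [//|p s hs] j /=.
  by rewrite /shift hs -scalerBl lieZr hs !scalerA mulrC.
rewrite /shift /= hs -scalerBl => /eqP; rewrite scaler_eq0 -intrB intr_eq0.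
by rewrite subr_eq0 eq_sym (negbTE zP) /= => /eqP /IHs; apply.
Qed.

Lemma root_space_free gamma delta x y : gamma != delta ->
  root_space h gamma x -> root_space h delta y -> x + y = 0 -> x = 0 /\ y = 0.
Proof.
move=> neq hx hy xy0.
have x0 : x = 0.
  apply: (root_space_off0 hx); rewrite -[x]addr0 -(subrr y) addrA xy0 add0r.
  apply: (root_space_off neq) => i.
  by rewrite lieNr hy scalerN.
by split=> //; move: xy0; rewrite x0 add0r.
Qed.

End RootSpaces.

(** * Triangular decomposition *)

Section KacMoody.
Context {K : numFieldType} {g : lieAlgType K} {n : nat} {A : 'M[int]_n}.
Implicit Types (e f h : 'I_n -> g) (x y : g) (U : set g) (c d : 'cV[int]_n).

Local Notation delta i := (delta_mx i 0 : 'cV[int]_n).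

Lemma lin_span_opp h : lin_span (fun i => - h i) = lin_span h.
Proof.
apply/seteqP; split=> _ [c ->]; exists (fun i => - c i); apply: eq_bigr => i _.
  by rewrite scalerN scaleNr.
by rewrite scalerN scaleNr opprK.
Qed.

Lemma root_space_opp h gamma :
  root_space (fun i => - h i) gamma = root_space h (- gamma).
Proof.
apply/seteqP; split=> x hx i; have := hx i; rewrite lieNl mxE mulrNz scaleNr.
  by move=> /eqP; rewrite eqr_oppLR => /eqP.
by move=> ->; rewrite opprK.
Qed.

(** The symmetry behind the Chevalley involution: every statement about the e_i transfers to the
    f_i. *)
Lemma kac_moody_swap e f h : is_kac_moody A e f h ->
  is_kac_moody A f e (fun i => - h i).
Proof.
move=> km; split.
- exact: km_nondegenerate km.
- move=> c c0 i; apply/eqP; rewrite -oppr_eq0; apply/eqP; move: i.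
  apply: (km_free km (c := fun i => - c i)); rewrite -[RHS]c0.
  by apply: eq_bigr => i _; rewrite scaleNr scalerN.
- by move=> i j; rewrite lieNl lieNr (km_hh km) !oppr0.
- by move=> i j; rewrite lieNl (km_hf km) opprK.
- by move=> i j; rewrite lieNl (km_he km).
- move=> i j; rewrite lieC (km_ef km) eq_sym; case: eqP => [->//|_].
  by rewrite oppr0.
- rewrite -(km_generated km); apply/seteqP; split=> x xS S [[Ssub SL] Sg];
    apply: xS; split=> //; move=> _ [[[i _ <-]|[i _ <-]]|[i _ <-]];
    try by apply: Sg; left; (left + right); exists i.
  + have [_ _ SZ] := Ssub; rewrite -scaleN1r.
    by apply: SZ; apply: Sg; right; exists i.
  + have [_ _ SZ] := Ssub; rewrite -[h i]opprK -scaleN1r.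
    by apply: SZ; apply: Sg; right; exists i.
- by move=> I II; rewrite lin_span_opp; apply: km_ideal km I II.
Qed.

(** [A] need not be invertible over the integers; its adjugate turns A c into (det A) c, and det A
    can be cancelled. Thus distinct degrees have distinct weights. *)
Lemma mulmx_inj_int : \det A != 0 -> injective (fun c => A *m c).
Proof.
move=> detA c d /(congr1 (mulmx (\adj A))); rewrite !mulmxA mul_adj_mx.
rewrite !mul_scalar_mx => /colP eqcd; apply/colP => i.
by have := eqcd i; rewrite !mxE => /(mulfI detA).
Qed.

Section Generation.
Variables (e f h : 'I_n -> g).
Hypothesis km : is_kac_moody A e f h.

(** By the Jacobi identity the x with ad x preserving [U] form a subalgebra, and it contains the
    generators. *)
Lemma ad_stable U : subspace U ->
  (forall i y, U y -> U [lie e i, y]) -> (forall i y, U y -> U [lie f i, y]) ->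
  (forall i y, U y -> U [lie h i, y]) -> forall x y, U y -> U [lie x, y].
Proof.
move=> Us Ue Uf Uh x; have [U0 UD UZ] := Us.
have : [set: g] x by [].
rewrite -(km_generated km).
apply: (_ : _ `<=` [set x | forall y, U y -> U [lie x, y]]).
apply: smallest_sub => [|_ [[[i _ <-]|[i _ <-]]|[i _ <-]] y /=]; last 3 first.
- exact: Ue.
- exact: Uf.
- exact: Uh.
split=> [|y z Sy Sz t Ut]; last first.
  have -> : [lie [lie y, z], t] = [lie y, [lie z, t]] - [lie z, [lie y, t]].
    by rewrite (lie_der y) addrK.
  by apply: subspaceB => //; [apply: Sy; apply: Sz|apply: Sz; apply: Sy].
split=> [y _|y z Sy Sz t Ut|c y Sy t Ut].
- by rewrite lie0l.
- by rewrite lieDl; apply: UD; [apply: Sy|apply: Sz].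
- by rewrite lieZl; apply: UZ; apply: Sy.
Qed.

Lemma ad_stable_full U : subspace U ->
  (forall i, U (e i)) -> (forall i, U (f i)) -> (forall i, U (h i)) ->
  (forall i y, U y -> U [lie e i, y]) -> (forall i y, U y -> U [lie f i, y]) ->
  (forall i y, U y -> U [lie h i, y]) -> forall x, U x.
Proof.
move=> Us Ue Uf Uh Ue' Uf' Uh' x; have : [set: g] x by [].
rewrite -(km_generated km); apply: smallest_sub.
  by split=> // y z _; apply: ad_stable.
by move=> _ [[[i _ <-]|[i _ <-]]|[i _ <-]].
Qed.

Lemma subalgebra_full U : lie_subalgebra U ->
  (forall i, U (e i)) -> (forall i, U (f i)) -> (forall i, U (h i)) ->
  forall x, U x.
Proof.
move=> Us Ue Uf Uh x; have : [set: g] x by [].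
rewrite -(km_generated km); apply: smallest_sub => //.
by move=> _ [[[i _ <-]|[i _ <-]]|[i _ <-]].
Qed.

End Generation.

(** Right-nested brackets of generators, indexed by their degree in the root lattice. The degree [c]
    is written in the basis of simple roots; its weight is [A *m c]. The bracket itself may be
    zero. *)
Inductive word (e : 'I_n -> g) : 'cV[int]_n -> g -> Prop :=
| word1 i : word e (delta i) (e i)
| wordS i c x : word e c x -> word e (delta i + c) [lie e i, x].

Lemma root_space_e e f h i : is_kac_moody A e f h ->
  root_space h (A *m delta i) (e i).
Proof. by move=> km j; rewrite (km_he km) -colE mxE. Qed.

Lemma root_space_f e f h i : is_kac_moody A e f h ->
  root_space h (- (A *m delta i)) (f i).
Proof. by move=> km j; rewrite (km_hf km) -colE !mxE mulrNz scaleNr. Qed.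

Lemma word_root_space e f h c x : is_kac_moody A e f h ->
  word e c x -> root_space h (A *m c) x.
Proof.
move=> km; elim=> {c x} [i|i c x _ IHx]; first exact: (root_space_e i km).
by rewrite mulmxDr; apply: root_space_lie => //; apply: (root_space_e i km).
Qed.

Lemma word_ge0 e c x : word e c x -> forall i, 0 <= c i 0.
Proof.
elim=> {c x} [i|i c x _ IHx] j; rewrite !mxE eqxx andbT //.
by rewrite addr_ge0.
Qed.

Lemma word_gt0 e c x : word e c x -> exists i, 0 < c i 0.
Proof.
case=> {c x} [i|i c x /word_ge0 c_ge0]; exists i; rewrite !mxE !eqxx //.
by rewrite ltr_pwDl.
Qed.

(** A word of length at least two in the single letter e_i ends in [e_i, e_i] = 0. *)
Lemma word_supp e c x i : word e c x -> (forall j, j != i -> c j 0 = 0) ->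
  x = 0 \/ c = delta i /\ x = e i.
Proof.
elim=> {c x} [j|j c x wx IHx] cj.
  have [->|neq] := eqVneq j i; first by right.
  by have := cj j neq; rewrite mxE !eqxx.
left; have c_ge0 := word_ge0 wx.
have eji : j = i.
  apply/eqP/negPn/negP => /cj; rewrite !mxE !eqxx => /eqP.
  by rewrite gt_eqF // ltr_pwDl.
case: IHx => [k neq|->|[_ ->]].
- have := cj k neq; rewrite !mxE eji eqxx andbT (negbTE neq) add0r.
  by [].
- by rewrite lie0r.
- by rewrite eji liexx.
Qed.

(** Moving ad f_i through the word by the Jacobi identity replaces a letter e_i by h_i, which acts
    on the remaining word as a scalar; a one-letter word yields h_i itself. *)
Lemma word_lower e f h i c x : is_kac_moody A e f h -> word e c x ->
  smallest subspace ([set y | exists d, word e d y] `|` range h) [lie f i, x].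
Proof.
move=> km; set V := smallest _ _; have Vs : subspace V by apply: smallest_subspace.
have [V0 VD VZ] := Vs.
have Vw d y : word e d y -> V y.
  by move=> wy; apply: sub_gen_smallest; left; exists d.
have Vh j : V (h j) by apply: sub_gen_smallest; right; exists j.
have Ve j y : V y -> V [lie e j, y].
  move: y; apply: smallest_subspaceP; first exact: preim_lie_subspace.
  move=> y [[d wy]|[k _ <-]] /=.
    by apply: Vw; apply: wordS wy.
  by rewrite lieC (km_he km) -scaleNr; apply: VZ; apply: Vw (word1 _ _).
elim=> {c x} [j|j c x wx IHx].
  rewrite lieC (km_ef km); case: eqP => _; last by rewrite oppr0.
  by rewrite -scaleN1r; apply: VZ.
rewrite lie_der; apply: VD; last exact: Ve.
rewrite lieC (lieC _ (e j)) (km_ef km); case: eqP => [_|_]; last first.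
  by rewrite oppr0 lie0r oppr0.
rewrite lieNr opprK lieC -scaleN1r; apply: (VZ).
by rewrite (word_root_space km wx); apply: VZ; apply: Vw wx.
Qed.

(** The spanning half of the triangular decomposition: the span of the e-words, the f-words and the
    h_i contains the generators and is stable under their adjoint action. *)
Lemma word_span e f h U : is_kac_moody A e f h -> subspace U ->
  (forall c x, word e c x -> U x) -> (forall c x, word f c x -> U x) ->
  (forall i, U (h i)) -> forall x, U x.
Proof.
move=> km Us Ue Uf Uh.
pose W := [set y | exists d, word e d y] `|` [set y | exists d, word f d y]
  `|` range h.
suff WT x : smallest subspace W x.
  move=> x; apply: (smallest_subspaceP _ _ (WT x)) => //.
  by move=> y [[[c wy]|[c wy]]|[i _ <-]]; [apply: Ue wy|apply: Uf wy|].
have Vs : subspace (smallest subspace W) by apply: smallest_subspace.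
have [V0 VD VZ] := Vs; move: {U Us Ue Uf Uh} x.
have Vw d y : word e d y -> smallest subspace W y.
  by move=> wy; apply: sub_gen_smallest; left; left; exists d.
have Vw' d y : word f d y -> smallest subspace W y.
  by move=> wy; apply: sub_gen_smallest; left; right; exists d.
have Vh j : smallest subspace W (h j) by apply: sub_gen_smallest; right; exists j.
have km' := kac_moody_swap km.
apply: (ad_stable_full km) => //.
- by move=> i; apply: Vw (word1 _ _).
- by move=> i; apply: Vw' (word1 _ _).
- move=> i; apply: smallest_subspaceP; first exact: preim_lie_subspace.
  move=> y [[[c wy]|[c wy]]|[j _ <-]] /=.
  + exact: Vw (wordS _ wy).
  + apply: (smallest_subspaceP _ _ (word_lower i km' wy)) => //.
    move=> z [[d wz]|[j _ <-]]; first exact: Vw' wz.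
    by rewrite -scaleN1r; apply: VZ.
  + by rewrite lieC (km_he km) -scaleNr; apply: VZ; apply: Vw (word1 _ _).
- move=> i; apply: smallest_subspaceP; first exact: preim_lie_subspace.
  move=> y [[[c wy]|[c wy]]|[j _ <-]] /=.
  + apply: (smallest_subspaceP _ _ (word_lower i km wy)) => //.
    by move=> z [[d wz]|[j _ <-]] //; apply: Vw wz.
  + exact: Vw' (wordS _ wy).
  + by rewrite lieC (km_hf km) opprK; apply: VZ; apply: Vw' (word1 _ _).
- move=> i; apply: smallest_subspaceP; first exact: preim_lie_subspace.
  move=> y [[[c wy]|[c wy]]|[j _ <-]] /=.
  + by rewrite (word_root_space km wy); apply: VZ; apply: Vw wy.
  + have := word_root_space km' wy; rewrite root_space_opp => ->.
    by apply: VZ; apply: Vw' wy.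
  + by rewrite (km_hh km).
Qed.

(** * Weight spaces and the degrees of words *)

Section WeightSpaces.
Variables (e f h : 'I_n -> g).
Hypothesis km : is_kac_moody A e f h.

(** Only words of degree d contribute to the weight space of d: x differs from a sum u of such words
    by vectors of other weights, while x - u has weight A d, so x = u. *)
Lemma root_space_sub U d : subspace U -> (forall x, word e d x -> U x) ->
  (forall x, word f (- d) x -> U x) -> (d = 0 -> forall i, U (h i)) ->
  root_space h (A *m d) `<=` U.
Proof.
move=> Us Ue Uf Uh x hx.
pose V := root_space h (A *m d).
have Vs : subspace V by apply: root_space_subspace.
have Os := off_root_space_subspace (km_hh km) (A *m d).
have inj := mulmx_inj_int (km_nondegenerate km).
(* Here [u] plays the role of the component of [y] of weight [A *m d]. *)
pose Q := [set y | exists u, [/\ U u, V u & off_root_space h (A *m d) (y - u)]].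
have [U0 UD UZ] := Us; have [V0 VD VZ] := Vs; have [oS0 oSD oSZ] := Os.
have Qs : subspace Q.
  split=> [|y z [u [Uu Vu Ou]] [v [Uv Vv Ov]]|k y [u [Uu Vu Ou]]].
  - by exists 0; split=> //; rewrite subr0.
  - exists (u + v); split; [exact: UD|exact: VD|].
    by rewrite opprD addrACA; apply: oSD.
  - exists (k *: u); split; [exact: UZ|exact: VZ|].
    by rewrite -scalerBr; apply: oSZ.
have Q1 y c : root_space h (A *m c) y -> (c = d -> U y) -> Q y.
  move=> hy Uy; have [eqc|neq] := eqVneq c d.
    by exists y; rewrite subrr; split=> //; [exact: Uy|rewrite /V -eqc].
  exists 0; rewrite subr0; split=> //; apply: root_space_off hy.
  by apply: contra_neq neq => /inj.
have : Q x.
  apply: (word_span km) => // [c y wy|c y wy|i].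
  - by apply: Q1 (word_root_space km wy) _ => eqc; apply: Ue; rewrite -eqc.
  - have := word_root_space (kac_moody_swap km) wy.
    rewrite root_space_opp -mulmxN => hy; apply: Q1 hy _ => eqc.
    by apply: Uf; rewrite -eqc opprK.
  - have := root_space_h (km_hh km) i; rewrite -(mulmx0 _ A) => hy.
    by apply: Q1 hy _ => eqd; apply: Uh.
move=> [u [Uu Vu Ou]]; suff /eqP : x - u = 0 by rewrite subr_eq0 => /eqP ->.
by apply: root_space_off0 Ou; exact: subspaceB Vs hx Vu.
Qed.

Lemma root_space0 : root_space h 0 `<=` lin_span h.
Proof.
rewrite -(mulmx0 _ A); apply: root_space_sub; first exact: lin_span_subspace.
- by move=> x wx; have [k] := word_gt0 wx; rewrite mxE ltxx.
- by move=> x wx; have [k] := word_gt0 wx; rewrite oppr0 mxE ltxx.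
- by move=> _ i; apply: mem_lin_span.
Qed.

Lemma root_space_mixed d i j : 0 < d i 0 -> d j 0 < 0 ->
  root_space h (A *m d) `<=` [set 0].
Proof.
move=> di dj; apply: root_space_sub; first exact: subspace0.
- by move=> x wx; have := word_ge0 wx j; rewrite leNgt dj.
- by move=> x wx; have := word_ge0 wx i; rewrite mxE oppr_ge0 leNgt di.
- by move=> d0; rewrite d0 mxE ltxx in di.
Qed.

Lemma root_space_multiple d i : (forall j, j != i -> d j 0 = 0) -> 1 < d i 0 ->
  root_space h (A *m d) `<=` [set 0].
Proof.
move=> dj di; apply: root_space_sub; first exact: subspace0.
- move=> x wx; case: (word_supp wx dj) => [->//|[eqd _]].
  by move: di; rewrite eqd mxE !eqxx ltxx.
- move=> x wx; have := word_ge0 wx i; rewrite mxE oppr_ge0 leNgt.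
  by rewrite (lt_trans _ di).
- by move=> d0; rewrite d0 mxE in di.
Qed.

Lemma root_space_simple i x : root_space h (A *m delta i) x ->
  exists c : K, x = c *: e i.
Proof.
move: x; apply: root_space_sub; first exact: line_subspace.
- move=> x wx; have [j neq|->|[_ ->]] := word_supp wx (i := i).
  + by rewrite mxE (negbTE neq).
  + by exists 0; rewrite scale0r.
  + by exists 1; rewrite scale1r.
- by move=> x wx; have := word_ge0 wx i; rewrite !mxE !eqxx.
- by move=> /matrixP /(_ i 0); rewrite !mxE !eqxx.
Qed.

Definition pos_weight c := (forall i, 0 <= c i 0) /\ exists i, 0 < c i 0.

Lemma pos_weightD c i : pos_weight c -> pos_weight (delta i + c).
Proof.
move=> [c_ge0 [j cj]]; split=> [k|].
  by rewrite !mxE eqxx andbT addr_ge0.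
by exists j; rewrite !mxE eqxx andbT ltr_wpDl.
Qed.

(* Such an x generates an ideal contained in the sum of the positive root spaces,
   hence meeting the Cartan subalgebra trivially. *)
Lemma no_lowest_vector c x : pos_weight c -> root_space h (A *m c) x ->
  (forall i, [lie f i, x] = 0) -> x = 0.
Proof.
move=> c_pos hx fx.
pose G := [set y | exists d, pos_weight d /\ root_space h (A *m d) y].
pose P := smallest subspace G.
have Ps : subspace P by apply: smallest_subspace.
have Pe i y : P y -> P [lie e i, y].
  move: y; apply: smallest_subspaceP; first exact: preim_lie_subspace.
  move=> y [d [dP hy]]; apply: sub_gen_smallest; exists (delta i + d).
  split; first exact: pos_weightD.
  by rewrite mulmxDr; apply: root_space_lie => //; apply: root_space_e i km.
(* [I] is the span of all iterated brackets of the e_i with [x]; it turns out to be the ideal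
   generated by [x]. *)
pose I := [set y | forall U, subspace U -> U x ->
  (forall i z, U z -> U [lie e i, z]) -> U y].
have Is : subspace I.
  split=> [U [U0 _ _] //|y z Iy Iz U Us Ux Ue|a y Iy U Us Ux Ue].
    by have [_ D _] := Us; apply: D; [apply: Iy|apply: Iz].
  by have [_ _ Z] := Us; apply: Z; apply: Iy.
have Ix : I x by move=> U.
have Ie i y : I y -> I [lie e i, y].
  by move=> Iy U Us Ux Ue; apply: (Ue); apply: Iy.
have [I0 ID IZ] := Is.
have Ih i y : I y -> I [lie h i, y].
  (* Membership of [y] is carried along because moving h_i past e_j leaves a multiple of [e_j, z],
     which lies in [I] only if z does. *)
  move=> Iy; suff [] : I y /\ I [lie h i, y] by [].
  apply: (Iy [set y | I y /\ I [lie h i, y]]).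
  - have [S0 SD SZ] := preim_lie_subspace (h i) Is.
    split=> /= [|u v [Iu hu] [Iv hv]|a u [Iu hu]]; split=> //.
    + exact: ID. + exact: SD. + exact: IZ. + exact: SZ.
  - by split=> //; rewrite hx; apply: IZ.
  - move=> j z [Iz hz]; split; first exact: Ie.
    rewrite lie_der (km_he km) lieZl; apply: ID; last exact: Ie.
    by apply: IZ; apply: Ie.
have If i y : I y -> I [lie f i, y].
  move=> Iy; suff [] : I y /\ I [lie f i, y] by [].
  apply: (Iy [set y | I y /\ I [lie f i, y]]).
  - have [S0 SD SZ] := preim_lie_subspace (f i) Is.
    split=> /= [|u v [Iu hu] [Iv hv]|a u [Iu hu]]; split=> //.
    + exact: ID. + exact: SD. + exact: IZ. + exact: SZ.
  - by split=> //; rewrite fx.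
  - move=> j z [Iz hz]; split; first exact: Ie.
    rewrite lie_der (lieC (f i)) (km_ef km); apply: ID; last exact: Ie.
    rewrite lieNl -scaleN1r; apply: (IZ).
    by case: eqP => _; [exact: Ih|rewrite lie0l].
have IP : I `<=` P.
  move=> y; apply => //.
  by apply: sub_gen_smallest; exists c.
have ideal : lie_ideal I by split=> // y z; apply: (ad_stable km).
suff : I = [set 0] by move=> I0'; have := Ix; rewrite I0'.
apply: (km_ideal km ideal); apply/seteqP; split=> [y [Iy hy]|_ ->]; last first.
  by split=> //; have [] := lin_span_subspace h.
have hy0 : root_space h 0 y.
  apply: subspace_lin_span hy; first exact: root_space_subspace.
  exact: root_space_h (km_hh km).
apply: (root_space_off0 hy0); apply: smallest_subspaceP (IP _ Iy).
  exact: off_root_space_subspace (km_hh km) 0.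
move=> z [d [[_ [j dj]] hz]]; apply: root_space_off hz.
rewrite -[X in X != _](mulmx0 _ A); apply/eqP.
move=> /(mulmx_inj_int (km_nondegenerate km)) d0.
by move: dj; rewrite -d0 mxE ltxx.
Qed.

End WeightSpaces.
End KacMoody.

(** * Strings of sl_2 *)

Section SL2.
Context {K : numFieldType} {g : lieAlgType K}.
Implicit Types (e f h v x y E Y : g) (mu p : K).

Definition sl2_relations e f h :=
  [/\ [lie h, e] = 2 *: e, [lie h, f] = - (2 *: f) & [lie e, f] = h].

Lemma sl2_relations_swap e f h :
  sl2_relations e f h -> sl2_relations f e (- h).
Proof. by move=> [he hf ef]; split; rewrite ?lieNl ?he ?hf ?opprK // lieC ef. Qed.

Lemma iter_lie0 x k : iter k (lie x) 0 = 0.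
Proof. by elim: k => //= k ->; rewrite lie0r. Qed.

(** Each transposition of e and f contributes a weight mu - 2l, and these sum over l <= k to (k +
    1)(mu - k). *)
Lemma highest_vector e f h v mu k : sl2_relations e f h ->
  [lie e, v] = 0 -> [lie h, v] = mu *: v ->
  [lie e, iter k.+1 (lie f) v] = (k.+1%:R * (mu - k%:R)) *: iter k (lie f) v.
Proof.
move=> [he hf ef] ev hv.
have hfk l : [lie h, iter l (lie f) v] = (mu - 2 * l%:R) *: iter l (lie f) v.
  elim: l => [|l IHl] /=; first by rewrite mulr0 subr0.
  rewrite lie_der hf IHl lieNl lieZl lieZr -scaleNr -scalerDl.
  by congr (_ *: _); rewrite -natr1; ring.
elim: k => [|k IHk]; first by rewrite /= lie_der ef ev hv lie0r addr0 mul1r subr0.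
rewrite iterS lie_der ef hfk IHk lieZr -iterS -scalerDl.
by congr (_ *: _); rewrite -!natr1; ring.
Qed.

Lemma lowest_vector e f h v mu k : sl2_relations e f h ->
  [lie f, v] = 0 -> [lie h, v] = - (mu *: v) ->
  [lie f, iter k.+1 (lie e) v] = (k.+1%:R * (mu - k%:R)) *: iter k (lie e) v.
Proof.
move=> /sl2_relations_swap ehf fv hv; apply: highest_vector ehf fv _.
by rewrite lieNl hv opprK.
Qed.

Lemma highest_vector_iter_neq0 e f h v m k : sl2_relations e f h ->
  [lie e, v] = 0 -> [lie h, v] = m%:R *: v -> v != 0 -> (k <= m)%N ->
  iter k (lie f) v != 0.
Proof.
move=> efh ev hv v0; elim: k => [//|k IHk] km.
apply/eqP => fkv; have := highest_vector k efh ev hv.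
rewrite fkv lie0r => /esym/eqP; rewrite scaler_eq0 mulf_eq0 pnatr_eq0 /=.
by rewrite subr_eq0 eqr_nat gtn_eqF // (negbTE (IHk (ltnW km))).
Qed.

Lemma last_nonzero_iter e x N : x != 0 -> iter N (lie e) x = 0 ->
  exists r, iter r (lie e) x != 0 /\ iter r.+1 (lie e) x = 0.
Proof.
elim: N x => [x /eqP//|N IHN x x0]; rewrite iterSr => eNx.
have [ex0|/eqP/IHN/(_ eNx) [r [rx0 rx]]] := [lie e, x] =P 0; first by exists 0%N.
by exists r.+1; rewrite (iterSr r) (iterSr r.+1).
Qed.

(** Raising x to the top of its string gives a highest vector of weight m + 2r, which survives m +
    2r lowerings; after m + r of them the weight is -m, the reflection of the weight of x. *)
Lemma sl2_string e f h x m N : sl2_relations e f h -> [lie h, x] = m%:R *: x ->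
  x != 0 -> iter N (lie e) x = 0 ->
  exists r, iter (m + r) (lie f) (iter r (lie e) x) != 0.
Proof.
move=> efh hx x0 /(last_nonzero_iter x0) [r [rx0 rx]]; exists r.
have [he _ _] := efh.
have hr : [lie h, iter r (lie e) x] = (m + r.*2)%:R *: iter r (lie e) x.
  elim: r {rx0 rx} => [|r IHr] /=; first by rewrite addn0.
  rewrite lie_der he IHr lieZl lieZr -scalerDl -natrD.
  by congr (_%:R *: _); rewrite doubleS; lia.
by apply: highest_vector_iter_neq0 efh rx hr rx0 _; lia.
Qed.

(* The reflection in exp(ad f) exp(-ad e) exp(ad f), evaluated on a bracket without
   exponentials: E_k and Y_k run through dual bases of the two strings, and the
   brackets [E_k, Y_k] and [E_k, Y_(k+1)] are computed by a joint induction. *)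
Lemma string_bracket e f h E Y mu p k : sl2_relations e f h ->
  [lie e, E] = 0 -> [lie h, E] = mu *: E ->
  [lie f, Y] = 0 -> [lie h, Y] = - (mu *: Y) ->
  [lie [lie E, Y], e] = (mu * p) *: e ->
  [lie iter k (lie f) E, iter k (lie e) Y] =
  ((-1) ^+ k * \prod_(l < k) (l.+1%:R * (mu - l%:R)))
    *: ([lie E, Y] - (k%:R * p) *: h).
Proof.
move=> efh eE hE fY hY ZE.
set D := fun k => (-1) ^+ k * \prod_(l < k) (l.+1%:R * (mu - l%:R)).
have DS l : D l.+1 = - (l.+1%:R * (mu - l%:R)) * D l.
  by rewrite /D exprS big_ord_recr /=; ring.
have eEk l := highest_vector l efh eE hE.
have fYk l := lowest_vector l efh fY hY.
have [he hf ef] := efh.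
(* Applying ad f to [E_k, Y_(k+1)] yields [E_(k+1), Y_(k+1)], and applying ad e to the latter yields
   [E_(k+1), Y_(k+2)]. *)
suff [] : [lie iter k (lie f) E, iter k (lie e) Y] =
    D k *: ([lie E, Y] - (k%:R * p) *: h) /\
  [lie iter k (lie f) E, iter k.+1 (lie e) Y] = (D k.+1 * p) *: e by [].
elim: k => [|k [IHZ IHT]].
  split; first by rewrite mul0r scale0r subr0 /D expr0 big_ord0 mulr1 scale1r.
  have := lie_der e E Y; rewrite eE lie0l add0r /= => <-.
  rewrite lieC ZE -scaleNr DS; congr (_ *: _).
  by rewrite /D expr0 big_ord0; ring.
have ZS : [lie iter k.+1 (lie f) E, iter k.+1 (lie e) Y] =
    D k.+1 *: ([lie E, Y] - (k.+1%:R * p) *: h).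
  have := lie_der f (iter k (lie f) E) (iter k.+1 (lie e) Y).
  rewrite IHT fYk !lieZr IHZ (lieC f) ef -iterS => /eqP.
  rewrite -subr_eq => /eqP <-.
  rewrite scalerN DS !scalerBr !scalerA opprB addrA -!(scaleNr _ h).
  rewrite -(scaleNr _ [lie E, Y]) -scalerDl addrC.
  by congr (_ *: _ + _ *: _); rewrite -?(natr1 k); ring.
split=> //.
have := lie_der e (iter k.+1 (lie f) E) (iter k.+1 (lie e) Y).
rewrite ZS eEk lieZl IHT -iterS => /eqP.
rewrite [X in _ == X]addrC -subr_eq => /eqP <-.
rewrite lieZr lieBr lieZr !(lieC e) ZE he scalerN opprK -(scaleNr _ e).
rewrite !scalerA scalerDr !scalerA -scalerDl -scalerBl; congr (_ *: _).
by rewrite (DS k.+1) -(natr1 k.+1) -(natr1 k); ring.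
Qed.

End SL2.

(** * Local nilpotency *)

Section Serre.
Context {K : numFieldType} {g : lieAlgType K} {n : nat} {A : 'M[int]_n}.
Variables (e f h : 'I_n -> g).
Hypothesis km : is_kac_moody A e f h.
Hypothesis A_diag : forall i, A i i = 2.
Implicit Types (c : 'cV[int]_n) (x y : g).

Local Notation delta i := (delta_mx i 0 : 'cV[int]_n).

Lemma km_sl2 i : sl2_relations (e i) (f i) (h i).
Proof.
by split; rewrite ?(km_he km) ?(km_hf km) ?(km_ef km) ?A_diag ?eqxx.
Qed.

Lemma iter_e_root_space i c x k : root_space h (A *m c) x ->
  root_space h (A *m (c + k%:Z *: delta i)) (iter k (lie (e i)) x).
Proof.
move=> hx; elim: k => [|k IHk] /=; first by rewrite scale0r addr0.
rewrite intS scalerDl scale1r addrCA mulmxDr.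
by apply: root_space_lie IHk; apply: root_space_e km.
Qed.

Lemma iter_f_root_space i c x k : root_space h (A *m c) x ->
  root_space h (A *m (c - k%:Z *: delta i)) (iter k (lie (f i)) x).
Proof.
move=> hx; elim: k => [|k IHk] /=; first by rewrite scale0r subr0.
rewrite intS scalerDl scale1r opprD addrCA mulmxDr mulmxN.
by apply: root_space_lie IHk; apply: root_space_f km.
Qed.

(** The Serre relation: the vector has positive weight and every f_k kills it, so [no_lowest_vector]
    applies. For k = i the coefficient N - N of the lowest vector formula vanishes. *)
Lemma serre i j (N : nat) : i != j -> A i j = - N%:Z -> (A i j = 0 -> A j i = 0) ->
  iter N.+1 (lie (e i)) (e j) = 0.
Proof.
move=> neq Aij Aji.
apply: (no_lowest_vector km (c := delta j + N.+1%:Z *: delta i)).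
- split=> [k|]; first by rewrite !mxE addr_ge0 // mulr_ge0.
  by exists i; rewrite !mxE !eqxx mulr1 ltr_wpDl.
- by apply: iter_e_root_space; apply: root_space_e km.
move=> k; have [->|neqk] := eqVneq k i.
  have fe : [lie f i, e j] = 0 by rewrite lieC (km_ef km) eq_sym (negbTE neq) oppr0.
  have he : [lie h i, e j] = - (N%:R *: e j).
    by rewrite (km_he km) Aij mulrNz scaleNr pmulrn.
  by rewrite (lowest_vector N (km_sl2 i) fe he) subrr mulr0 scale0r.
have -> r : [lie f k, iter r (lie (e i)) (e j)] =
    iter r (lie (e i)) [lie f k, e j].
  elim: r => //= r <-.
  by rewrite lie_der (lieC (f k)) (km_ef km) eq_sym (negbTE neqk) oppr0 lie0l add0r.
rewrite lieC (km_ef km); case: eqP => [_|_]; last by rewrite oppr0 iter_lie0.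
rewrite iterSr lieNr lieC opprK (km_he km).
(* What is left is a multiple A j i of e_i. If N = 0 this coefficient vanishes; otherwise a further
   bracket with e_i kills it. *)
case: N Aij => [|N] Aij; first by rewrite Aji ?scale0r // Aij oppr0.
by rewrite iterSr lieZr liexx scaler0 iter_lie0.
Qed.

(** In Leibniz's rule each term applies ad y at least N times to x or at least M times to z; peeling
    off one bracket at a time avoids the binomial expansion. *)
Lemma leibniz_nilpotent y N M x z :
  iter N (lie y) x = 0 -> iter M (lie y) z = 0 ->
  iter (N + M) (lie y) [lie x, z] = 0.
Proof.
have iter0 k v : v = 0 -> iter k (lie y) v = 0 by move=> ->; exact: iter_lie0.
have iterD k u v : iter k (lie y) (u + v) = iter k (lie y) u + iter k (lie y) v.
  by elim: k => //= k ->; rewrite lieDr.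
have [s] := ubnP (N + M); elim: s N M x z => // s IHs [|N] [|M] x z NMs Nx Mz.
- by apply: iter0; rewrite [x]Nx lie0l.
- by apply: iter0; rewrite [x]Nx lie0l.
- by apply: iter0; rewrite [z]Mz lie0r.
rewrite addnS iterSr lie_der iterD.
rewrite [X in _ + X]IHs ?addr0; [|by lia|exact: Nx|by rewrite -iterSr].
by rewrite addSnnS IHs // -iterSr.
Qed.

(** The vectors killed by a power of ad e_i form a subalgebra, and it contains the generators: the
    e_j by the Serre relations, the f_j and h_j directly. *)
Lemma ad_e_nilpotent : (forall i j, i != j -> A i j <= 0) ->
  (forall i j, A i j = 0 -> A j i = 0) ->
  forall i x, exists N, iter N (lie (e i)) x = 0.
Proof.
move=> A_off A0 i.
apply: (subalgebra_full km (U := [set x | exists N, iter N (lie (e i)) x = 0])).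
- have iterDx k (u v : g) : iter k (lie (e i)) (u + v) =
      iter k (lie (e i)) u + iter k (lie (e i)) v.
    by elim: k => //= k ->; rewrite lieDr.
  split=> [|x y [N Nx] [M My]]; last by exists (N + M)%N; apply: leibniz_nilpotent.
  split=> [|x y [N Nx] [M My]|a x [N Nx]].
  + by exists 0%N.
  + exists (N + M)%N; rewrite iterDx {1}addnC !iterD Nx My.
    by rewrite !iter_lie0 addr0.
  + exists N; suff -> k : iter k (lie (e i)) (a *: x) = a *: iter k (lie (e i)) x.
      by rewrite Nx scaler0.
    by elim: k => //= k ->; rewrite lieZr.
- move=> j; have [<-|neq] := eqVneq i j; first by exists 1%N; rewrite /= liexx.
  exists `|A i j|%N.+1; apply: serre => //; last exact: A0.
  by have := A_off _ _ neq; lia.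
- move=> j; exists 3; rewrite /= (km_ef km); case: eqP => [->|_]; last first.
    by rewrite !lie0r.
  by rewrite (lieC _ (h j)) (km_he km) lieNr lieZr liexx scaler0 oppr0.
- move=> j; exists 2.
  by rewrite /= (lieC _ (h j)) (km_he km) lieNr lieZr liexx scaler0 oppr0.
Qed.

(** By [sl2_string] a nonzero vector of degree c produces a nonzero one of the reflected degree s_i
    c = c - m alpha_i. *)
Lemma root_space_reflect : (forall i j, i != j -> A i j <= 0) ->
  (forall i j, A i j = 0 -> A j i = 0) ->
  forall i c (m : nat), (A *m c) i 0 = m%:Z ->
  root_space h (A *m (c - m%:Z *: delta i)) `<=` [set 0] ->
  root_space h (A *m c) `<=` [set 0].
Proof.
move=> A_off A0 i c m cm refl0 x hx /=.
apply/eqP/negPn/negP => x0; have [N Nx] := ad_e_nilpotent A_off A0 i x.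
have hix : [lie h i, x] = m%:R *: x by rewrite hx cm pmulrn.
have [r /negP] := sl2_string (km_sl2 i) hix x0 Nx; apply; apply/eqP/refl0.
have := iter_f_root_space i (m + r) (iter_e_root_space i r hx).
suff -> : c + r%:Z *: delta i - (m + r)%:Z *: delta i = c - m%:Z *: delta i by [].
by rewrite PoszD scalerDl opprD addrACA subrr addr0.
Qed.

End Serre.

(** * The action of the Cartan subalgebra on root spaces *)

Section Cartan.
Context {K : numFieldType} {g : lieAlgType K} {n : nat} (h : 'I_n -> g).
Implicit Types (c gamma : 'cV[int]_n) (x y v : g).

Lemma lie_span_root_space (b : 'I_n -> K) gamma x : root_space h gamma x ->
  [lie \sum_i b i *: h i, x] = (\sum_i b i * (gamma i 0)%:~R) *: x.
Proof.
move=> hx; rewrite scaler_suml.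
have -> : [lie \sum_i b i *: h i, x] = \sum_i [lie b i *: h i, x].
  by apply: (big_morph (fun y => [lie y, x])) => [y z|]; rewrite ?lieDl ?lie0l.
by apply: eq_bigr => i _; rewrite lieZl hx scalerA.
Qed.

(* For a symmetric Cartan matrix this is the image of [\sum_i c_i alpha_i] under
   the identification of the dual of the Cartan subalgebra with itself. *)
Definition coroot c : g := \sum_i (c i 0)%:~R *: h i.

Lemma lie_coroot c gamma x : root_space h gamma x ->
  [lie coroot c, x] = (\sum_i c i 0 * gamma i 0)%:~R *: x.
Proof.
move=> /lie_span_root_space ->; rewrite rmorph_sum; congr (_ *: _).
by apply: eq_bigr => i _; rewrite rmorphM.
Qed.

Lemma coroot_span c : lin_span h (coroot c).
Proof. by exists (fun i => (c i 0)%:~R). Qed.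

Lemma lin_span_comm u v : (forall i j, [lie h i, h j] = 0) ->
  lin_span h u -> lin_span h v -> [lie u, v] = 0.
Proof.
move=> hh [b ->] hv; have hv0 : root_space h 0 v.
  by apply: subspace_lin_span hv; [exact: root_space_subspace|exact: root_space_h].
rewrite (lie_span_root_space _ hv0) big1 ?scale0r // => i _.
by rewrite mxE mulr0.
Qed.

End Cartan.

(** * The compact involution *)

Section Involution.
Context {R : realType} {g : lieAlgType R[i]} {n : nat}.
Variables (e f h : 'I_n -> g) (omega : g -> g).
Hypothesis omegaP : is_compact_involution e f h omega.

Lemma omega0 : omega 0 = 0.
Proof. by have := ci_antilinear omegaP 0 0; rewrite !scale0r rmorph0 scale0r. Qed.

Lemma omega_inj : injective omega.
Proof. exact: bij_inj (ci_bij omegaP). Qed.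

Lemma omega_root_space gamma x :
  root_space h gamma x -> root_space h (- gamma) (omega x).
Proof.
move=> hx i; apply: oppr_inj; rewrite -lieNl -(ci_h omegaP) -(ci_lie omegaP) hx.
by rewrite (ci_antilinear omegaP) rmorph_int !mxE mulrNz scaleNr opprK.
Qed.

Lemma omega_iter_f i x k :
  omega (iter k (lie (f i)) x) = (-1) ^+ k *: iter k (lie (e i)) (omega x).
Proof.
elim: k => [|k IHk] /=; first by rewrite scale1r.
rewrite (ci_lie omegaP) (ci_f omegaP) IHk lieZr lieNl exprS mulN1r scaleNr.
by rewrite scalerN.
Qed.

End Involution.

(** * Real roots in rank two *)

Section RankTwo.
Variables (a : int).
Hypothesis a_ge3 : 3 <= a.
Local Notation A := (cartan_matrix a).
Local Notation delta i := (delta_mx i 0 : 'cV[int]_2).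
Implicit Types (c d : 'cV[int]_2).

Lemma ord2_neq (i j : 'I_2) : i != j -> i = 0 /\ j = 1 \/ i = 1 /\ j = 0.
Proof.
by case: i => [[|[|//]] ?]; case: j => [[|[|//]] ?] // _; [left|right];
  split; apply/val_inj.
Qed.

Lemma cartan_diag i : A i i = 2.
Proof. by rewrite mxE eqxx. Qed.

Lemma cartan_off i j : i != j -> A i j <= 0.
Proof. by rewrite mxE => /negbTE->; lia. Qed.

Lemma cartan_eq0 i j : A i j = 0 -> A j i = 0.
Proof. by rewrite !mxE eq_sym; case: eqP => // _ /eqP; lia. Qed.

Lemma cartan_mul i j c : i != j -> (A *m c) i 0 = 2 * c i 0 - a * c j 0.
Proof.
move=> ij; rewrite mxE !big_ord_recl big_ord0 !mxE addr0.
have -> : lift ord0 ord0 = 1 :> 'I_2 by apply/val_inj.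
case: (ord2_neq ij) => -[-> ->] /=; first by rewrite mulNr.
by rewrite mulNr addrC.
Qed.

(* Half the square norm of the root lattice element [\sum_i c_i alpha_i]. *)
Definition qnorm c : int := c 0 0 ^+ 2 - a * c 0 0 * c 1 0 + c 1 0 ^+ 2.

Lemma qnormE i j c : i != j ->
  qnorm c = c i 0 ^+ 2 - a * c i 0 * c j 0 + c j 0 ^+ 2.
Proof.
rewrite /qnorm => /ord2_neq[[-> ->]//|[-> ->]].
by move: (c 0 0) (c 1 0) => x y; ring.
Qed.

Lemma qnormN c : qnorm (- c) = qnorm c.
Proof. by rewrite /qnorm !mxE; ring. Qed.

(** Since 2 qnorm(c) = c_0 (A c)_0 + c_1 (A c)_1, the two values (A c)_i cannot both be
    nonpositive. *)
Lemma qnorm_descent c : 0 < c 0 0 -> 0 < c 1 0 -> 0 < qnorm c ->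
  exists i j : 'I_2, [/\ i != j, 0 < c i 0, 0 < c j 0
    & 0 < (A *m c) i 0].
Proof.
move=> c0 c1 qc; case: (ltP 0 (2 * c 0 0 - a * c 1 0)) => h0.
  by exists 0, 1; rewrite (@cartan_mul 0 1).
exists 1, 0; rewrite (@cartan_mul 1 0) //; split=> //.
rewrite ltNge; apply/negP => h1; move: qc; rewrite /qnorm.
by move: (c 0 0) (c 1 0) c0 c1 h0 h1 => x y; nia.
Qed.

Lemma reflect_self i j c (m : int) : i != j -> (A *m c) i 0 = m ->
  (c - m *: delta i) i 0 = a * c j 0 - c i 0.
Proof.
by move=> ij <-; rewrite (cartan_mul _ ij) !mxE !eqxx /=; ring.
Qed.

Lemma reflect_other i j c (m : int) : i != j -> (c - m *: delta i) j 0 = c j 0.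
Proof. by move=> ij; rewrite !mxE eq_sym (negbTE ij) mulr0 subr0. Qed.

Lemma qnorm_reflect i j c (m : int) : i != j -> (A *m c) i 0 = m ->
  qnorm (c - m *: delta i) = qnorm c.
Proof.
move=> ij cm; rewrite !(qnormE _ ij) (reflect_self ij cm) (reflect_other _ _ ij).
by ring.
Qed.

(** * Vanishing of root spaces of norm above that of a real root *)

Section Roots.
Context {K : numFieldType} {g : lieAlgType K} (e f h : 'I_2 -> g).
Hypothesis km : is_kac_moody A e f h.

(** Reflecting at an i with (A c)_i > 0 keeps [qnorm] and lowers the height. The descent ends at k
    alpha_i with k > 1 or at coordinates of opposite signs, and neither degree carries a nonzero
    word. *)
Lemma root_space_qnorm c : 0 <= c 0 0 -> 0 <= c 1 0 -> 1 < qnorm c ->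
  root_space h (A *m c) `<=` [set 0].
Proof.
have [s] := ubnP (absz (c 0 0 + c 1 0)); elim: s c => // s IHs c cs c0 c1 qc.
have [c00|c0n] := eqVneq (c 0 0) 0.
  apply: (root_space_multiple km (i := 1)).
    by move=> j /ord2_neq[[->]|[->]].
  by move: qc; rewrite /qnorm c00; nia.
have [c10|c1n] := eqVneq (c 1 0) 0.
  apply: (root_space_multiple km (i := 0)).
    by move=> j /ord2_neq[[->]|[->]].
  by move: qc; rewrite /qnorm c10; nia.
have [|||i [j [ij ci cj mi]]] := @qnorm_descent c; [lia..|].
have cm : (A *m c) i 0 = (absz ((A *m c) i 0))%:Z by lia.
apply: (root_space_reflect km cartan_diag cartan_off cartan_eq0 cm).
set m := absz _ in cm *.
have ri := reflect_self ij cm; have rj := reflect_other c m ij.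
have [neg|pos] := ltP ((c - m%:Z *: delta i) i 0) 0.
  by apply: (root_space_mixed km (i := j) _ neg); rewrite rj.
have qr := qnorm_reflect ij cm.
apply: IHs; rewrite ?qr //.
- have ci' : (c - m%:Z *: delta i) i 0 = c i 0 - m%:Z by rewrite !mxE !eqxx mulr1.
  by case: (ord2_neq ij) => -[? ?]; subst i j; rewrite rj ci' in pos *; lia.
- by case: (ord2_neq ij) => -[? ?]; subst i j; rewrite ?rj.
- by case: (ord2_neq ij) => -[? ?]; subst i j; rewrite ?rj.
Qed.

End Roots.

(** * The bracket of a real root vector with its image under the involution *)

Section CompactForm.
Context {R : realType} {g : lieAlgType R[i]} (e f h : 'I_2 -> g) (omega : g -> g).
Hypothesis km : is_kac_moody A e f h.
Hypothesis omegaP : is_compact_involution e f h omega.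

(** [omega] exchanges the root spaces of c and -c, which reduces to nonnegative coordinates; for
    opposite signs the space is zero anyway. *)
Lemma root_space_qnorm_gt1 c : 1 < qnorm c -> root_space h (A *m c) `<=` [set 0].
Proof.
move=> qc.
have neg : c 0 0 <= 0 -> c 1 0 <= 0 -> root_space h (A *m c) `<=` [set 0].
  move=> c0 c1 x hx; apply: (omega_inj omegaP); rewrite (omega0 omegaP).
  apply: (root_space_qnorm km (c := - c)); rewrite ?qnormN ?mulmxN //.
  + by rewrite mxE oppr_ge0. + by rewrite mxE oppr_ge0.
  + exact: omega_root_space omegaP _ _ hx.
have [c0|c0] := leP 0 (c 0 0); have [c1|c1] := leP 0 (c 1 0).
- exact: (root_space_qnorm km).
- have [c00|c0n] := eqVneq (c 0 0) 0; first by apply: neg; rewrite ?c00 // ltW.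
  by apply: (root_space_mixed km (i := 0) _ c1); lia.
- have [c10|c1n] := eqVneq (c 1 0) 0; first by apply: neg; rewrite ?c10 // ltW.
  by apply: (root_space_mixed km (i := 1) _ c0); lia.
- by apply: neg; apply: ltW.
Qed.

Lemma simple_root_bracket i E : root_space h (A *m delta i) E ->
  exists2 p : R[i], 0 <= p & [lie E, omega E] = - (p *: coroot h (delta i)).
Proof.
move=> /(root_space_simple km) [k ->]; exists (k * k^*%C).
  by rewrite -normCK; apply: exprn_ge0.
rewrite (ci_antilinear omegaP) (ci_e omegaP) lieZl lieZr lieNr (km_ef km) eqxx.
rewrite /coroot (bigD1 i) //= big1 ?addr0 => [|j ji].
  by rewrite mxE !eqxx scale1r !scalerN scalerA.
by rewrite mxE (negbTE ji) scale0r.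
Qed.

(* The minus sign is the definiteness of the invariant Hermitian form on real root
   spaces. *)
Lemma real_root_bracket c E : 0 <= c 0 0 -> 0 <= c 1 0 -> qnorm c = 1 ->
  root_space h (A *m c) E ->
  exists2 p : R[i], 0 <= p & [lie E, omega E] = - (p *: coroot h c).
Proof.
have [s] := ubnP (absz (c 0 0 + c 1 0)); elim: s c E => // s IHs c E cs c0 c1 qc hE.
have [c00|c0n] := eqVneq (c 0 0) 0.
  have eqc : c = delta 1.
    apply/colP => k; rewrite mxE eqxx andbT.
    have [->|neq] := eqVneq k 1; first by move: qc; rewrite /qnorm c00 /=; nia.
    by have [[-> //]|[-> //]] := ord2_neq neq.
  by rewrite eqc; apply: simple_root_bracket; rewrite -eqc.
have [c10|c1n] := eqVneq (c 1 0) 0.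
  have eqc : c = delta 0.
    apply/colP => k; rewrite mxE eqxx andbT.
    have [->|neq] := eqVneq k 0; first by move: qc; rewrite /qnorm c10 /=; nia.
    by have [[-> //]|[-> //]] := ord2_neq neq.
  by rewrite eqc; apply: simple_root_bracket; rewrite -eqc.
have [|||i [j [ij ci cj mi]]] := @qnorm_descent c; [lia..|].
have cm : (A *m c) i 0 = (absz ((A *m c) i 0))%:Z by lia.
set m := absz _ in cm; have m_gt0 : (0 < m)%N by lia.
have mK0 : m%:R != 0 :> R[i] by rewrite pnatr_eq0 -lt0n.
have ri := reflect_self ij cm; have rj := reflect_other c m ij.
have qr := qnorm_reflect ij cm.
(* With x < 0 < y the form x^2 - a x y + y^2 would exceed 1. *)
have ri_ge0 : 0 <= (c - m%:Z *: delta i) i 0.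
  rewrite leNgt; apply/negP; move: qr; rewrite qc (qnormE _ ij) rj.
  by move: (_ i 0) (c j 0) cj => x y; nia.
have := iter_f_root_space km i m hE.
have /IHs IH : (absz ((c - m%:Z *: delta i)%R 0%R 0%R
    + (c - m%:Z *: delta i)%R 1%R 0%R)%R < s)%N.
  have ci' : (c - m%:Z *: delta i) i 0 = c i 0 - m%:Z by rewrite !mxE !eqxx mulr1.
  by case: (ord2_neq ij) => -[? ?]; subst i j; rewrite rj ci' in ri_ge0 *; lia.
move=> /IH [|||p p_ge0]; rewrite ?qr //.
- by case: (ord2_neq ij) => -[? ?]; subst i j; rewrite ?rj.
- by case: (ord2_neq ij) => -[? ?]; subst i j; rewrite ?rj.
(* The norm of c + alpha_i is 2 + (A c)_i > 1, so c is the top of its i-string. *)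
have eE : [lie e i, E] = 0.
  apply: (root_space_qnorm_gt1 (c := delta i + c)).
    move: qc; rewrite !(qnormE _ ij) !mxE !eqxx eq_sym (negbTE ij) /= add0r.
    by move: mi; rewrite (cartan_mul _ ij); nia.
  by rewrite mulmxDr; apply: root_space_lie hE; apply: root_space_e km.
have hEi : [lie h i, E] = m%:R *: E by rewrite hE cm pmulrn.
have fY : [lie f i, omega E] = 0.
  apply: oppr_inj; rewrite oppr0 -lieNl -(ci_e omegaP) -(ci_lie omegaP) eE.
  exact: omega0 omegaP.
have hY : [lie h i, omega E] = - (m%:R *: omega E).
  by rewrite (omega_root_space omegaP hE) mxE cm mulrNz scaleNr pmulrn.
have [b Zb] : lin_span h [lie E, omega E].
  apply: (root_space0 km); rewrite -(subrr (A *m c)).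
  exact: root_space_lie hE (omega_root_space omegaP hE).
set alpha := \sum_k b k * ((A *m delta i) k 0)%:~R.
have Ze : [lie [lie E, omega E], e i] = alpha *: e i.
  by rewrite Zb; apply: lie_span_root_space; apply: root_space_e km.
have ei0 : e i != 0.
  apply/eqP => ei0; have := km_ef km i i; rewrite ei0 lie0l eqxx => hi0.
  have S0 : \sum_k (k == i)%:R *: h k = 0.
    rewrite (bigD1 i) //= -hi0 scaler0 add0r big1 // => k /negbTE->.
    by rewrite scale0r.
  by have /eqP := km_free km S0 i; rewrite eqxx oner_eq0.
(* With alpha / m as the parameter p of [string_bracket], the h_i-term at k = m becomes alpha
   h_i. *)
have Ze' : [lie [lie E, omega E], e i] = (m%:R * (alpha / m%:R)) *: e i.
  by rewrite Ze mulrC divfK.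
have := string_bracket m (km_sl2 km cartan_diag i) eE hEi fY hY Ze'.
rewrite (mulrC m%:R) divfK //; set P := \prod_(l < m) _ => brk.
have P_gt0 : 0 < P.
  apply: prodr_gt0 => l _; rewrite mulr_gt0 ?ltr0n // subr_gt0 ltr_nat.
  exact: ltn_ord.
(* The sign (-1)^m from [omega] cancels that of [string_bracket], leaving the positive factor [P];
   this is what preserves the sign of p. *)
rewrite (omega_iter_f omegaP) lieZr brk scalerA mulrA -exprMn mulrNN mul1r.
rewrite expr1n mul1r.
set Z := [lie E, omega E] in Ze *; set nu := coroot _ _ => eqZ.
have {}eqZ : Z - alpha *: h i = - ((p / P) *: nu).
  rewrite [p / P]mulrC -scalerA -[in RHS]scalerN -eqZ scalerA.
  by rewrite mulVf ?scale1r // gt_eqF.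
(* Both sides of [eqZ] act on e_i: the left one by alpha - 2 alpha, and [nu] by (A s_i c)_i = -m. *)
have alphaE : alpha = - (p / P * m%:R).
  have := congr1 (fun y => [lie y, e i]) eqZ.
  rewrite /= lieDl !lieNl !lieZl Ze (km_he km) cartan_diag.
  rewrite (lie_coroot _ (root_space_e i km)).
  have -> : \sum_k (c - m%:Z *: delta i) k 0 * (A *m delta i) k 0 = - m%:Z.
    transitivity ((A *m (c - m%:Z *: delta i)) i 0).
      rewrite [RHS]mxE; apply: eq_bigr => k _.
      by rewrite -colE !mxE eq_sym mulrC.
    by rewrite mulmxBr -scalemxAr -colE mxE cm !mxE eqxx; lia.
  rewrite mulrNz -pmulrn !scalerA mulrN scaleNr opprK -scalerBl => /eqP.
  rewrite -subr_eq0 -scalerBl scaler_eq0 (negbTE ei0) orbF => /eqP alpha0.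
  transitivity (- (p / P * m%:R) - (alpha - alpha * 2%:~R - p / P * m%:R)).
    by ring.
  by rewrite alpha0 subr0.
exists (p / P); first by rewrite divr_ge0 // ltW.
(* The bracket is now -(p / P)(m h_i + nu(s_i c)), and the sum in parentheses is nu(c). *)
move/(canRL (subrK _)): eqZ => ->; rewrite alphaE scaleNr -opprD.
congr (- _); rewrite -[(p / P * m%:R) *: _]scalerA -scalerDr; congr (_ *: _).
rewrite /nu /coroot (bigD1 i) //= [RHS](bigD1 i) //= addrAC; congr (_ + _).
  by rewrite -scalerDl !mxE !eqxx mulr1 rmorphB /= -pmulrn subrK.
by apply: eq_bigr => k ki; rewrite !mxE (negbTE ki) mulr0 subr0.
Qed.

End CompactForm.
End RankTwo.

(** * The Casimir eigenvalue *)

Section Eigenvalue.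
Context {R : realType} (a : int).
Hypothesis a_ge3 : 3 <= a.
Local Notation A := (cartan_matrix a).
Context {g : lieAlgType R[i]} (e f h : 'I_2 -> g) (omega : g -> g).
Hypothesis km : is_kac_moody A e f h.
Hypothesis omegaP : is_compact_involution e f h omega.
Implicit Types (c d : 'cV[int]_2).

(** The invariant bilinear form on the root lattice; its negative at the two chosen roots is the
    number B. *)
Definition pairing c d : int := \sum_k c k 0 * (A *m d) k 0.

Lemma pairingE c d : pairing c d =
  2 * (c 0 0 * d 0 0 + c 1 0 * d 1 0) - a * (c 0 0 * d 1 0 + c 1 0 * d 0 0).
Proof.
rewrite /pairing !big_ord_recl big_ord0 addr0.
have -> : lift ord0 ord0 = 1 :> 'I_2 by apply/val_inj.
by rewrite (@cartan_mul a 0 1) // (@cartan_mul a 1 0) //; ring.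
Qed.

Lemma pairingC c d : pairing c d = pairing d c.
Proof. by rewrite !pairingE; ring. Qed.

Lemma pairing_self c : pairing c c = 2 * qnorm a c.
Proof. by rewrite pairingE /qnorm; ring. Qed.

Lemma qnormB c d : qnorm a (c - d) = qnorm a c + qnorm a d - pairing c d.
Proof. by rewrite pairingE /qnorm !mxE; ring. Qed.

(* By the Gram identity [pairing c d ^ 2 - 4 = (a ^ 2 - 4) (c_0 d_1 - c_1 d_0) ^ 2]
   the two roots are linearly independent. *)
Lemma cartan_separated c d (b : 'I_2 -> R[i]) : qnorm a c = 1 -> qnorm a d = 1 ->
  pairing c d < - 2 ->
  \sum_k b k * ((A *m c) k 0)%:~R = 0 -> \sum_k b k * ((A *m d) k 0)%:~R = 0 ->
  forall k, b k = 0.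
Proof.
move=> qc qd B_gt2.
have D0 : c 0 0 * d 1 0 - c 1 0 * d 0 0 != 0.
  apply/eqP => D0; have : pairing c d ^+ 2 - 4 * (qnorm a c * qnorm a d) =
      (a ^+ 2 - 4) * (c 0 0 * d 1 0 - c 1 0 * d 0 0) ^+ 2.
    by rewrite pairingE /qnorm; ring.
  by rewrite D0 qc qd; nia.
have a0 : (a ^+ 2 - 4)%:~R != 0 :> R[i] by rewrite intr_eq0; apply/eqP; nia.
rewrite !big_ord_recl !big_ord0 !addr0.
have -> : lift ord0 ord0 = 1 :> 'I_2 by apply/val_inj.
rewrite !(@cartan_mul a 0 1) // !(@cartan_mul a 1 0) // !rmorphB !rmorphM /=.
move: D0; rewrite -(intr_eq0 R[i]) rmorphB !rmorphM /=.
move: a0; rewrite rmorphB rmorphXn /=.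
have : (4%:~R = 4 :> R[i]) /\ (2%:~R = 2 :> R[i]) by [].
move=> [-> ->].
move: (c 0 0)%:~R (c 1 0)%:~R (d 0 0)%:~R (d 1 0)%:~R (a%:~R) => c0 c1 d0 d1 a'.
have -> : ord0 = 0 :> 'I_2 by [].
move=> a0 D0 hc hd.
(* Cramer's rule: up to sign the determinant of the system in b_0, b_1 is det A times that of c,
   d. *)
have x0 : (a' ^+ 2 - 4) * (c0 * d1 - c1 * d0) * b 0 = 0.
  transitivity ((a' * d0 - 2 * d1) *
        (b 0 * (2 * c0 - a' * c1) + b 1 * (2 * c1 - a' * c0))
     - (a' * c0 - 2 * c1) * (b 0 * (2 * d0 - a' * d1) + b 1 * (2 * d1 - a' * d0))).
    by ring.
  by rewrite hc hd !mulr0 subr0.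
have y0 : (a' ^+ 2 - 4) * (c0 * d1 - c1 * d0) * b 1 = 0.
  transitivity ((2 * d0 - a' * d1) *
        (b 0 * (2 * c0 - a' * c1) + b 1 * (2 * c1 - a' * c0))
     - (2 * c0 - a' * c1) * (b 0 * (2 * d0 - a' * d1) + b 1 * (2 * d1 - a' * d0))).
    by ring.
  by rewrite hc hd !mulr0 subr0.
have aD : (a' ^+ 2 - 4) * (c0 * d1 - c1 * d0) != 0 by rewrite mulf_neq0.
move=> k; have [->|/ord2_neq[[-> _]|[-> _]]] := eqVneq k 1.
- by apply/eqP; move/eqP: y0; rewrite mulf_eq0 (negbTE aD).
- by apply/eqP; move/eqP: x0; rewrite mulf_eq0 (negbTE aD).
- by apply/eqP; move/eqP: y0; rewrite mulf_eq0 (negbTE aD).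
Qed.

(** If v in the Cartan subalgebra takes the values b0, b1 on the two roots, the Casimir element
    sends it to (q/2)(b0 nu(c) + b1 nu(d)). On (b0, b1) this is q/2 times the matrix with rows (2,
    -B) and (-B, 2), with eigenvalue 1 on b0 = b1 and -(B + 2)/(B - 2) on b0 = -b1. *)
Lemma casimir_eigenvalue c d (E0 E1 : g) (k0 k1 z : R[i]) :
  [/\ 0 <= c 0 0, 0 <= c 1 0 & qnorm a c = 1] ->
  [/\ 0 <= d 0 0, 0 <= d 1 0 & qnorm a d = 1] -> pairing c d < - 2 ->
  root_space h (A *m c) E0 -> E0 != 0 -> root_space h (A *m d) E1 -> E1 != 0 ->
  let X := k0 *: E0 + k1 *: E1 in
  let Y := omega X in
  let H := [lie X, Y] in
  X != 0 -> [lie H, X] = 2 *: X ->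
  eigenvalue_on (lin_span h) (casimir X Y H) z -> z != 1 ->
  z = - (((- pairing c d)%:~R + 2) / ((- pairing c d)%:~R - 2)).
Proof.
move=> [c0 c1 qc] [d0 d1 qd] B_gt2 hE0 E00 hE1 E10 X Y H Xn0 HX zE z_neq1.
have [p0 p0_ge0 W0] := real_root_bracket a_ge3 km omegaP c0 c1 qc hE0.
have [p1 p1_ge0 W1] := real_root_bracket a_ge3 km omegaP d0 d1 qd hE1.
have hY0 := omega_root_space omegaP hE0; have hY1 := omega_root_space omegaP hE1.
(* The norm of c - d is 2 - (c, d) > 1, so the mixed brackets vanish. *)
have W01 : [lie E0, omega E1] = 0.
  apply: (root_space_qnorm_gt1 a_ge3 km omegaP (c := c - d)).
    by rewrite qnormB qc qd; lia.
  by rewrite mulmxBr; apply: root_space_lie.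
have W10 : [lie E1, omega E0] = 0.
  apply: (root_space_qnorm_gt1 a_ge3 km omegaP (c := d - c)).
    by rewrite qnormB qc qd pairingC; lia.
  by rewrite mulmxBr; apply: root_space_lie.
have brk (s0 s1 t0 t1 : R[i]) :
    [lie s0 *: E0 + s1 *: E1, t0 *: omega E0 + t1 *: omega E1] =
    (- (s0 * t0 * p0)) *: coroot h c + (- (s1 * t1 * p1)) *: coroot h d.
  rewrite !lieDl !lieDr !lieZl !lieZr W01 W10 W0 W1 !scaler0 addr0 add0r.
  by rewrite !scalerN !scalerA !scaleNr.
have YE : Y = k0^*%C *: omega E0 + k1^*%C *: omega E1.
  by rewrite /Y /X (ci_add omegaP) !(ci_antilinear omegaP).
pose q0 := - (k0 * k0^*%C * p0); pose q1 := - (k1 * k1^*%C * p1).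
have q0_le0 : q0 <= 0.
  by rewrite /q0 oppr_le0 mulr_ge0 // -normCK exprn_ge0.
have q1_le0 : q1 <= 0.
  by rewrite /q1 oppr_le0 mulr_ge0 // -normCK exprn_ge0.
have HE : H = q0 *: coroot h c + q1 *: coroot h d by rewrite /H YE brk.
have [B BE] : exists B : R[i], B = (- pairing c d)%:~R by eexists.
have cE0 : [lie coroot h c, E0] = 2 *: E0.
  by rewrite (lie_coroot _ hE0) -/(pairing c c) pairing_self qc mulr1.
have dE1 : [lie coroot h d, E1] = 2 *: E1.
  by rewrite (lie_coroot _ hE1) -/(pairing d d) pairing_self qd mulr1.
have dE0 : [lie coroot h d, E0] = - B *: E0.
  by rewrite (lie_coroot _ hE0) -/(pairing d c) pairingC BE mulrNz opprK.
have cE1 : [lie coroot h c, E1] = - B *: E1.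
  by rewrite (lie_coroot _ hE1) -/(pairing c d) BE mulrNz opprK.
have neq : A *m c != A *m d.
  apply/eqP => /(mulmx_inj_int (km_nondegenerate km)) eqcd.
  by move: B_gt2; rewrite eqcd pairing_self qd.
have HXE : [lie H, X] =
    (k0 * (2 * q0 - B * q1)) *: E0 + (k1 * (2 * q1 - B * q0)) *: E1.
  rewrite HE /X !lieDl !lieDr !lieZl !lieZr cE0 dE1 dE0 cE1 !scalerA.
  by rewrite addrACA -!scalerDl; congr (_ *: _ + _ *: _); ring.
have [/eqP eq0 /eqP eq1] : (k0 * (2 * q0 - B * q1 - 2)) *: E0 = 0 /\
    (k1 * (2 * q1 - B * q0 - 2)) *: E1 = 0.
  have [_ _ Zc] := root_space_subspace h (A *m c).
  have [_ _ Zd] := root_space_subspace h (A *m d).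
  apply: (root_space_free neq); [exact: Zc|exact: Zd|].
  rewrite -[RHS](subrr (2 *: X)) -{1}HX HXE /X scalerDr !scalerA.
  rewrite [in RHS]opprD [RHS]addrACA.
  by rewrite -!scalerBl; congr (_ *: _ + _ *: _); ring.
move: eq0 eq1; rewrite !scaler_eq0 (negbTE E00) (negbTE E10) !orbF ?mulf_eq0.
(* If one coefficient of X were zero, the equation of the other would read 2q = 2, against q <=
   0. *)
have neg_neq1 (q : R[i]) : q <= 0 -> 2 * q - 2 != 0.
  move=> q_le0; rewrite subr_eq0 lt_eqF //; apply: (@le_lt_trans _ _ 0) => //.
  by rewrite pmulr_rle0.
have [k00|k0n] := eqVneq k0 0.
  have q00 : q0 = 0 by rewrite /q0 k00 !mul0r oppr0.
  have [k10|k1n] := eqVneq k1 0.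
    by move: Xn0; rewrite /X k00 k10 !scale0r addr0 eqxx.
  by rewrite q00 !mulr0 subr0 /= (negbTE (neg_neq1 _ q1_le0)).
have [k10|k1n] := eqVneq k1 0.
  have q10 : q1 = 0 by rewrite /q1 k10 !mul0r oppr0.
  by rewrite q10 !mulr0 subr0 /= (negbTE (neg_neq1 _ q0_le0)).
rewrite /= => /eqP eq0 /eqP eq1.
have B_gt2' : 2 < B.
  have : 2 < - pairing c d by clear -B_gt2; lia.
  by rewrite BE -(ltr_int R[i]).
have B2n : B + 2 != 0 by rewrite gt_eqF // addr_gt0 // (lt_trans _ B_gt2').
have B2n' : B - 2 != 0 by rewrite gt_eqF // subr_gt0.
have eqq : q1 = q0.
  apply/eqP; rewrite -subr_eq0; apply/eqP; apply: (mulfI B2n); rewrite mulr0.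
  transitivity ((2 * q1 - B * q0 - 2) - (2 * q0 - B * q1 - 2)); first by ring.
  by rewrite eq0 eq1 subrr.
have q0E : q0 = - (2 / (B - 2)).
  apply: (mulfI B2n').
  have -> : (B - 2) * - (2 / (B - 2)) = - 2 by field.
  transitivity (- (2 * q0 - B * q0 - 2) - 2); first by ring.
  by move: eq0; rewrite eqq => ->; rewrite oppr0 add0r.
have [v [[b vE] v0 vz]] := zE.
pose b0 := \sum_k b k * ((A *m c) k 0)%:~R.
pose b1 := \sum_k b k * ((A *m d) k 0)%:~R.
have vE0 : [lie v, E0] = b0 *: E0 by rewrite vE; apply: lie_span_root_space.
have vE1 : [lie v, E1] = b1 *: E1 by rewrite vE; apply: lie_span_root_space.
have opp_sum (c' : 'cV[int]_2) : \sum_k b k * ((- (A *m c')) k 0)%:~R =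
    - \sum_k b k * ((A *m c') k 0)%:~R.
  by rewrite -sumrN; apply: eq_bigr => k _; rewrite mxE mulrNz mulrN.
have vY0 : [lie omega E0, v] = b0 *: omega E0.
  by rewrite lieC vE (lie_span_root_space _ hY0) opp_sum scaleNr opprK.
have vY1 : [lie omega E1, v] = b1 *: omega E1.
  by rewrite lieC vE (lie_span_root_space _ hY1) opp_sum scaleNr opprK.
have Yv : [lie Y, v] = (k0^*%C * b0) *: omega E0 + (k1^*%C * b1) *: omega E1.
  by rewrite YE lieDl !lieZl vY0 vY1 !scalerA.
have XYv : [lie X, [lie Y, v]] =
    (q0 * b0) *: coroot h c + (q1 * b1) *: coroot h d.
  rewrite Yv brk /q0 /q1.
  by congr (_ *: _ + _ *: _); ring.
have YXv : [lie Y, [lie X, v]] = [lie X, [lie Y, v]].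
  have Xv : [lie v, X] = (k0 * b0) *: E0 + (k1 * b1) *: E1.
    by rewrite lieDr !lieZr vE0 vE1 !scalerA.
  rewrite XYv (lieC X v) lieNr lieC opprK Xv YE brk.
  by rewrite /q0 /q1; congr (_ *: _ + _ *: _); ring.
have Hv : [lie H, v] = 0.
  apply: lin_span_comm (km_hh km) _ _; last by exists b.
  have [_ D Z] := lin_span_subspace h.
  by rewrite HE; apply: D; apply: Z; apply: coroot_span.
have zvE : z *: v = (q0 / 2 * b0) *: coroot h c + (q0 / 2 * b1) *: coroot h d.
  rewrite -vz /casimir Hv lie0r scaler0 add0r YXv XYv -scalerDl scalerDr.
  rewrite !scalerA eqq.
  by congr (_ *: _ + _ *: _); field.
have scaleI (x : g) k l : x != 0 -> k *: x = l *: x -> k = l.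
  move=> /negbTE x0 /eqP; rewrite -subr_eq0 -scalerBl scaler_eq0 x0 orbF.
  by rewrite subr_eq0 => /eqP.
have zb0 : z * b0 = q0 / 2 * (2 * b0 - B * b1).
  apply: (scaleI _ _ _ E00); rewrite -scalerA -vE0 -lieZl zvE.
  rewrite lieDl !lieZl cE0 dE0 !scalerA -scalerDl; congr (_ *: _); ring.
have zb1 : z * b1 = q0 / 2 * (2 * b1 - B * b0).
  apply: (scaleI _ _ _ E10); rewrite -scalerA -vE1 -lieZl zvE.
  rewrite lieDl !lieZl cE1 dE1 !scalerA -scalerDl; congr (_ *: _); ring.
(* Adding the two eigenvalue equations gives (z - 1)(b0 + b1) = 0. *)
have sum0 : b0 + b1 = 0.
  have : (z - 1) * (b0 + b1) = 0.
    rewrite mulrBl mul1r mulrDr zb0 zb1 q0E; field.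
    by [].
  by move=> /eqP; rewrite mulf_eq0 subr_eq0 (negbTE z_neq1) => /eqP.
have b1E : b1 = - b0 by apply/eqP; rewrite -addr_eq0 addrC sum0.
(* Otherwise both roots vanish on v, and independent roots force v = 0. *)
have b0n : b0 != 0.
  apply/eqP => b00; move: v0; rewrite vE big1 ?eqxx // => k _.
  rewrite (cartan_separated qc qd B_gt2 b00) ?scale0r //.
  by rewrite -/b1 b1E b00 oppr0.
apply: (mulIf b0n); rewrite zb0 b1E q0E -BE; field.
by [].
Qed.

End Eigenvalue.

(** * The sequence F *)

Section Sequence.
Variable a : int.
Hypothesis a_ge3 : 3 <= a.

Lemma F_rec k : F a k.+2 = a * F a k.+1 - F a k.
Proof. by []. Qed.

Lemma F_ge0_lt k : 0 <= F a k /\ F a k < F a k.+1.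
Proof.
elim: k => [//|k]; rewrite F_rec.
by move: (F a k) (F a k.+1) => x y [x0 xy]; split; nia.
Qed.

Lemma F_ge0 k : 0 <= F a k. Proof. by have [] := F_ge0_lt k. Qed.

(** The form x^2 - a x y + y^2 is invariant under the recursion step (x, y) -> (a x - y, x). *)
Lemma F_quadratic k : F a k.+1 ^+ 2 - a * F a k.+1 * F a k + F a k ^+ 2 = 1.
Proof.
elim: k => [|k IHk]; first by rewrite /=; ring.
by rewrite -[RHS]IHk F_rec; ring.
Qed.

(** The left side is unchanged when one unit is moved from i to j. *)
Lemma F_add i j : F a i.+1 * F a j.+1 - F a i * F a j = F a (i + j).+1.
Proof.
elim: i j => [|i IHi] j; first by rewrite /= mul1r mul0r subr0.
by rewrite addSnnS -IHi !F_rec; ring.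
Qed.

(** Coordinates in the simple roots, whereas [beta0] lists the values on the h_i. *)
Definition root0 i : 'cV[int]_2 := F a i.+1 *: delta_mx 0 0 + F a i *: delta_mx 1 0.
Definition root1 j : 'cV[int]_2 := F a j *: delta_mx 0 0 + F a j.+1 *: delta_mx 1 0.

Lemma beta0E i : beta0 a i = cartan_matrix a *m root0 i.
Proof. by rewrite /beta0 /simple_root !colE mulmxDr -!scalemxAr. Qed.

Lemma beta1E j : beta1 a j = cartan_matrix a *m root1 j.
Proof. by rewrite /beta1 /simple_root !colE mulmxDr -!scalemxAr. Qed.

Lemma root0_entries i : root0 i 0 0 = F a i.+1 /\ root0 i 1 0 = F a i.
Proof. by rewrite !mxE /= !mulr1 !mulr0 addr0 add0r. Qed.

Lemma root1_entries j : root1 j 0 0 = F a j /\ root1 j 1 0 = F a j.+1.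
Proof. by rewrite !mxE /= !mulr1 !mulr0 addr0 add0r. Qed.

Lemma root0_real i :
  [/\ 0 <= root0 i 0 0, 0 <= root0 i 1 0 & qnorm a (root0 i) = 1].
Proof.
have [r0 r1] := root0_entries i; rewrite /qnorm r0 r1.
by split; rewrite ?F_ge0 // F_quadratic.
Qed.

Lemma root1_real j :
  [/\ 0 <= root1 j 0 0, 0 <= root1 j 1 0 & qnorm a (root1 j) = 1].
Proof.
have [r0 r1] := root1_entries j; rewrite /qnorm r0 r1.
by split; rewrite ?F_ge0 // -[RHS](F_quadratic j); ring.
Qed.

Definition Fgap s := F a s.+2 - F a s.

Lemma pairing_roots i j : - pairing a (root0 i) (root1 j) = Fgap (i + j).
Proof.
have [r00 r01] := root0_entries i; have [r10 r11] := root1_entries j.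
rewrite pairingE r00 r01 r10 r11 /Fgap -addnS -F_add.
have -> : F a (i + j) = F a i.+1 * F a j + F a i * F a j.+1 - a * (F a i * F a j).
  (* [F_add] yields only successor indices, hence the separate case i = 0. *)
  case: i {r00 r01} => [|i]; first by rewrite /= !mul0r mul1r mulr0 subr0 addr0.
  by rewrite addSn -F_add !F_rec; ring.
by rewrite F_rec; ring.
Qed.

Lemma Fgap0 : Fgap 0 = a.
Proof. by rewrite /Fgap /= mulr1 subr0 subr0. Qed.

Lemma FgapS s : Fgap s < Fgap s.+1.
Proof.
rewrite /Fgap (F_rec s.+1); have [] := F_ge0_lt s.+1; have [] := F_ge0_lt s.
by move: (F a s) (F a s.+1) (F a s.+2) => x y z; nia.
Qed.

Lemma Fgap_lt s t : (s < t)%N -> Fgap s < Fgap t.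
Proof.
elim: t => // t IHt; rewrite ltnS leq_eqVlt => /orP[/eqP->|/IHt st].
  exact: FgapS.
exact: lt_trans st (FgapS t).
Qed.

Lemma Fgap_ge s : a + s%:Z <= Fgap s.
Proof.
elim: s => [|s IHs]; first by rewrite Fgap0 addr0.
by have := FgapS s; lia.
Qed.

End Sequence.

(** * Monotonicity, bounds and limits of the eigenvalue *)

Section Values.
Variables (R : realType) (a : int).
Hypothesis a_ge3 : 3 <= a.

(** The form of -(B + 2)/(B - 2) in which B occurs once, so that monotonicity and the limit can be
    read off. *)
Definition Eplus_value s : R[i] := -1 - 4 / (Fgap a s - 2)%:~R.

Lemma Fgap_gt0 s : 0 < (Fgap a s - 2)%:~R :> R[i].
Proof. by rewrite ltr0z; have := Fgap_ge a_ge3 s; lia. Qed.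

Lemma Eplus_valueE s :
  - (((Fgap a s)%:~R + 2) / ((Fgap a s)%:~R - 2)) = Eplus_value s.
Proof.
have := Fgap_gt0 s; rewrite /Eplus_value rmorphB /= => /lt0r_neq0.
by move: (Fgap a s)%:~R => x x0; field.
Qed.

Lemma Eplus_value_lt s t : (s < t)%N -> Eplus_value s < Eplus_value t.
Proof.
move=> st; rewrite ltrD2l ltrN2 ltr_pM2l // ltf_pV2 ?posrE ?Fgap_gt0 //.
by rewrite ltr_int ltrD2r Fgap_lt.
Qed.

Lemma Eplus_value_lt_N1 s : Eplus_value s < -1.
Proof. by rewrite gtrDl oppr_lt0 divr_gt0 // Fgap_gt0. Qed.

(** B - 2 >= a + s - 2 >= s + 1. *)
Lemma Eplus_value_dist s : `|-1 - Eplus_value s| <= 4 / s.+1%:R.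
Proof.
rewrite /Eplus_value opprD addrA subrr add0r opprK ger0_norm; last first.
  by rewrite divr_ge0 // ltW // Fgap_gt0.
rewrite ler_pM2l // lef_pV2 ?posrE ?Fgap_gt0 ?ltr0n //.
by rewrite pmulrn ler_int; have := Fgap_ge a_ge3 s; lia.
Qed.

(** A positive element of [R[i]] is real, so the Archimedean property of [R] applies. *)
Lemma inv_nat_lt (eps : R[i]) : 0 < eps -> exists N : nat, 4 / N.+1%:R < eps.
Proof.
move=> eps_gt0; have [r r_gt0 ->] : exists2 r : R, 0 < r & eps = r%:C.
  case: eps eps_gt0 => x y; rewrite ltcE /= => /andP[/eqP -> x0].
  by exists x.
exists (Num.truncn (4 / r)).
rewrite -[4]/(4%:R) -!(rmorph_nat (@real_complex R)) -fmorphV -rmorphM ltcR.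
rewrite ltr_pdivrMr ?ltr0n // mulrC -ltr_pdivrMr //.
exact: truncnS_gt.
Qed.

Lemma Eplus_value_cvg (u : nat -> nat) : (forall s, (s <= u s)%N) ->
  (fun s => Eplus_value (u s)) @ \oo --> (-1 : R[i]^o).
Proof.
move=> le_u; apply/(@cvgrPdist_lt _ R[i]^o) => eps /inv_nat_lt [N Neps].
exists N => // s /= Ns; apply: le_lt_trans (Eplus_value_dist _) _.
apply: le_lt_trans Neps; rewrite ler_pM2l // lef_pV2 ?posrE ?ltr0n // ler_nat.
by rewrite ltnS (leq_trans Ns).
Qed.

End Values.

(* The order on R[i] is the partial one for which x <= y means that y - x is a
   nonnegative real; in particular the bounds below say that E i j is real.
   R[i]^o is R[i] with the topology given by its norm. *)
Theorem proposition7p3 (R : realType) (a : int) (a_ge3 : 3 <= a)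
  (g : lieAlgType R[i]) (e f h : 'I_2 -> g)
  (g_km : is_kac_moody (cartan_matrix a) e f h)
  (omega : g -> g) (omegaP : is_compact_involution e f h omega)
  (E : nat -> nat -> R[i])
  (EP : forall i j, is_Eplus a e f h omega i j (E i j)) :
  [/\ forall i i' j, (i < i')%N -> E i j < E i' j,
      forall i j j', (j < j')%N -> E i j < E i j',
      forall i j, - ((a%:~R + 2) / (a%:~R - 2)) <= E i j /\ E i j < -1,
      forall j, (fun i => E i j) @ \oo --> (-1 : R[i]^o)
    & forall i, (fun j => E i j) @ \oo --> (-1 : R[i]^o)].
Proof.
have EE i j : E i j = Eplus_value R a (i + j).
  have [E0 [E1 [c0 [c1 [[h0 E00] [h1 E10] sl2 eig z1]]]]] := EP i j.
  move: sl2 => [[X0 _ _] [_ [HX _ _]]].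
  rewrite -Eplus_valueE // -pairing_roots //.
  apply: (casimir_eigenvalue a_ge3 g_km omegaP (root0_real a_ge3 i)
    (root1_real a_ge3 j) _ _ E00 _ E10 X0 HX eig z1).
  - by rewrite -ltrN2 pairing_roots //; have := Fgap_ge a_ge3 (i + j); lia.
  - by rewrite -beta0E.
  - by rewrite -beta1E.
split.
- by move=> i i' j ii'; rewrite !EE Eplus_value_lt // ltn_add2r.
- by move=> i j j' jj'; rewrite !EE Eplus_value_lt // ltn_add2l.
- move=> i j; rewrite EE; split; last exact: Eplus_value_lt_N1.
  (* The lower bound is the value at i = j = 0, where B = a. *)
  rewrite -{1 2}(Fgap0 a) Eplus_valueE //; case: (i + j)%N => // s.
  by apply/ltW/Eplus_value_lt.
- move=> j; rewrite (_ : (fun i => E i j) = fun i => Eplus_value R a (i + j)).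
    by apply: Eplus_value_cvg => // s; exact: leq_addr.
  by apply/funext => i.
- move=> i; rewrite (_ : (fun j => E i j) = fun j => Eplus_value R a (i + j)).
    by apply: Eplus_value_cvg => // s; exact: leq_addl.
  by apply/funext => j.
Qed.
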